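(* Let $p$ be a prime with $p\equiv 1\pmod 3$, and write $p=A^2+3B^2$ with $A,B\in\mathbb{Z}$ and $A\equiv 1\pmod 3$. Then $$\sum_{k=0}^{p-1}\frac{\binom{2k}{k}\binom{3k}{k}}{54^k}\equiv 2A-\frac{p}{2A}\pmod{p^2}.$$
   Context: Congruences modulo $p^2$ are taken in the ring $\mathbb{Z}_p$ of rational numbers whose denominator is coprime to $p$: for $u,v$ in this ring, $u\equiv v\pmod{p^2}$ means $(u-v)/p^2$ lies in this ring. *)

(* Defs.v *)
From HB Require Import structures.
From mathcomp Require Import all_boot all_order all_algebra.

Set Implicit Arguments.
Unset Strict Implicit.
Unset Printing Implicit Defensive.

Import Order.TTheory GRing.Theory Num.Theory.
Local Open Scope ring_scope.

Definition pintegral (p : nat) : pred rat :=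
  fun x => coprime `|denq x|%N p.

(* Membership of both sides in the ring is part of the congruence: it does not
   follow from the integrality of (u - v) / p ^ 2. *)
Definition congr_psqr (p : nat) (u v : rat) : bool :=
  [&& u \in pintegral p, v \in pintegral p
    & (u - v) / p%:R ^+ 2 \in pintegral p].

(* Main.v *)
Require Import Defs.
From HB Require Import structures.
From mathcomp Require Import all_boot all_order all_algebra.
From mathcomp Require Import all_solvable all_field.
From mathcomp Require Import zify ring.

Set Implicit Arguments.
Unset Strict Implicit.
Unset Printing Implicit Defensive.

Import Order.TTheory GRing.Theory Num.Theory.
Local Open Scope ring_scope.

(** Write p = 6m + 1 and C = binomial(3m, m), let H_n be the n-th harmonic
    number modulo p, and put K = H_m / 6 + H_2m / 3 - H_3m / 2. The congruence
    follows by evaluating two quantities modulo p^2 in terms of C and K.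

    The first is the sum of the quadratic character over the values of x^3 + 1
    on F_p. Its twists by the three classes modulo cubes are integers with sum 0
    and sum of squares 6p, and it is even, so half of it is the first component
    of a representation of p by u^2 + 3 v^2 (cubic_sum_form). Such a
    representation is unique up to signs (sqr_form3_uniq) and the sum is 1
    modulo 3 (cubic_sum1_mod3); hence it equals -2A. To reduce it modulo p^2,
    evaluate the character by p(p-1)/2-th powers at the Teichmueller points
    X, which satisfy X^p = X. Then (1 + X)^p is 1 + X plus p times a truncated
    logarithm, and the orthogonality of the powers of X turns the sum into
    binomial sums with harmonic values. The outcome (cubic_sum_lift) is
    2A = C + p / C + p C K.

    The second is the hypergeometric sum. Its k-th term is the product over
    i < k of (a - i)(a + 1 + i), divided by (-2)^k k!^2, at
    a = -1/3 = 2m - p/3. With S(a) the sum of the first p terms,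
    (a + 1) S(a + 1) + a S(a - 1) is a single boundary product
    (hyper_sum_contiguous), and modulo p^2 this product vanishes when a is
    congruent to neither 0 nor -1 modulo p, because it then contains two
    multiples of p. So S can be lowered from 2m - p/3 in steps of 2 down to
    -p/3, where only the terms linear in p survive and give a truncated
    logarithm at 1/2. Expanding the product of the ratios to first order in p
    yields S = C + p C K, with the same K (hyper_sum_lift); the two forms of K
    agree because H_2m - H_m = - H_3m (harm_trisect) and because the truncated
    logarithm of 1/2 is - H_3m / 2 (sum_log_half).

    Subtracting, S = 2A - p / C, and C = 2A modulo p. *)


(** * Primitive roots of a finite field *)

Section PrimitiveRoot.
Variables (F : finFieldType) (n : nat).
Hypothesis cardF : #|F| = n.+1.

Lemma expf_unit (x : F) : x != 0 -> x ^+ n = 1.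
Proof. by move=> x0; apply: (mulfI x0); rewrite mulr1 -exprS -cardF expf_card. Qed.

Lemma exists_prim_root : exists g : F, n.-primitive_root g.
Proof.
have n0 : (0 < n)%N by have := finNzRing_gt1 F; rewrite cardF.
have : has n.-primitive_root (enum (predC1 (0 : F))).
  apply: has_prim_root => //.
  - by apply/allP => x; rewrite mem_enum inE => x0; apply/unity_rootP/expf_unit.
  - exact: enum_uniq.
  - by rewrite -cardE cardC1 cardF.
by case/hasP => g _ Hg; exists g.
Qed.

Lemma sum_prim_root (V : nmodType) (g : F) (f : F -> V) : n.-primitive_root g ->
  \sum_x f x = f 0 + \sum_(i < n) f (g ^+ i).
Proof.
move=> pg; have n0 := prim_order_gt0 pg.
have g0 : g != 0 by rewrite (prim_root_eq0 pg) -lt0n.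
rewrite (bigD1 0) //=; congr (_ + _).
have injg : {in iota 0 n &, injective (fun i => g ^+ i)}.
  move=> i j; rewrite !mem_iota /= !add0n => li lj /eqP.
  by rewrite (eq_prim_root_expr pg) !modn_small // => /eqP.
have uq : uniq [seq g ^+ i | i <- iota 0 n] by rewrite map_inj_in_uniq ?iota_uniq.
have sub : {subset [seq g ^+ i | i <- iota 0 n] <= enum (predC1 (0 : F))}.
  by move=> x /mapP[i _ ->]; rewrite mem_enum inE expf_neq0.
have sz : (size (enum (predC1 (0%R : F))) <= size [seq g ^+ i | i <- iota 0 n])%N.
  by rewrite size_map size_iota -cardE cardC1 cardF.
have [_ eqm] := uniq_min_size uq sub sz.
have pe : perm_eq [seq g ^+ i | i <- iota 0 n] (enum (predC1 (0 : F))).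
  exact: uniq_perm uq (enum_uniq _) eqm.
rewrite -big_enum -(perm_big _ pe) big_map.
by rewrite -[n]subn0 -/(index_iota 0 n) big_mkord subn0.
Qed.
End PrimitiveRoot.

(** * The quadratic character of an odd finite field *)

Section QuadraticCharacter.
Variables (F : finFieldType) (h : nat).
Hypothesis cardF : #|F| = (2 * h).+1.

Definition qchar (x : F) : int :=
  if x == 0 then 0 else if x ^+ h == 1 then 1 else -1.

Lemma odd_card_two_neq0 : (2 : F) != 0.
Proof.
have [g pg] := exists_prim_root cardF.
by apply: (prim_root_dvd_eq0 pg); rewrite dvdn_mulr.
Qed.

Lemma oner_neqN1 : (1 : F) == -1 = false.
Proof. by rewrite -subr_eq0 opprK (negbTE odd_card_two_neq0). Qed.

Lemma half_card_gt0 : (0 < h)%N.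
Proof. by have := finNzRing_gt1 F; rewrite cardF; case: h. Qed.

Lemma qchar_exp (x : F) : (qchar x)%:~R = x ^+ h.
Proof.
rewrite /qchar; have [->|x0] := eqVneq x 0; first by rewrite expr0n eqn0Ngt half_card_gt0.
have [-> //|ne] := eqVneq (x ^+ h) 1.
have : (x ^+ h) ^+ 2 == 1 by rewrite -exprM mulnC (expf_unit cardF).
by rewrite sqrf_eq1 (negbTE ne) => /eqP ->; rewrite rmorphN.
Qed.

Lemma qchar0 : qchar 0 = 0.
Proof. by rewrite /qchar eqxx. Qed.

Lemma qchar1 : qchar 1 = 1.
Proof. by rewrite /qchar oner_eq0 expr1n eqxx. Qed.

Lemma qcharM : {morph qchar : x y / x * y}.
Proof.
move=> x y; have := qchar_exp x; have := qchar_exp y; have := qchar_exp (x * y).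
rewrite exprMn /qchar mulf_eq0 exprMn.
have [_|x0] := eqVneq x 0; first by rewrite mul0r.
have [_|y0] /= := eqVneq y 0; first by rewrite mulr0.
have N1 : ((-1 : F) == 1) = false by rewrite eq_sym oner_neqN1.
case: (x ^+ h == 1); case: (y ^+ h == 1) => /= + <- <-;
  by rewrite ?rmorphN ?rmorph1 ?mulrN ?mulNr ?mulr1 ?opprK ?eqxx ?N1 ?eqxx.
Qed.

Lemma qchar_sqr x : x != 0 -> qchar x ^+ 2 = 1.
Proof. by rewrite /qchar => /negbTE ->; case: ifP. Qed.

Lemma sum_qchar : \sum_x qchar x = 0.
Proof.
have [g pg] := exists_prim_root cardF.
have g0 : g != 0 by rewrite (prim_root_eq0 pg) -lt0n muln_gt0 half_card_gt0.
have qg : qchar g = -1.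
  rewrite /qchar (negbTE g0) -(prim_order_dvd pg) gtnNdvd ?half_card_gt0 //.
  by have := half_card_gt0; lia.
suff : \sum_x qchar x = - \sum_x qchar x by lia.
rewrite {1}(reindex (fun x => g * x)) /=; last first.
  by exists (fun x => g^-1 * x) => x _; rewrite ?mulKf ?mulVKf.
by rewrite -mulN1r mulr_sumr; apply: eq_bigr => x _; rewrite qcharM qg.
Qed.

(** For distinct a and b, (k + a)(k + b) is up to a square the ratio
    (k + a) / (k + b), which runs over all values but 1. *)
Lemma sum_qchar_shift (a b : F) :
  \sum_k qchar ((k + a) * (k + b)) = (#|F| * (a == b))%:Z - 1.
Proof.
have sub c : \sum_k qchar (k + c) = 0.
  apply: etrans sum_qchar; rewrite [RHS](reindex (fun x => x + c)) //=.
  by exists (fun x => x - c) => x _; rewrite ?addrK ?subrK.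
have [<-|nab] := eqVneq a b.
  rewrite (bigD1 (- a)) //= addNr mul0r qchar0 add0r muln1.
  rewrite (eq_bigr (fun=> 1)) => [|k ka]; last first.
    by rewrite qcharM -expr2 qchar_sqr // addr_eq0.
  by rewrite sumr_const cardC1 cardF /= -natz; lia.
rewrite muln0 sub0r (bigD1 (- b)) //= addNr mulr0 qchar0 add0r.
have e k : k != - b -> qchar ((k + a) * (k + b)) = qchar (1 + (a - b) / (k + b)).
  rewrite -addr_eq0 => kb.
  have -> : (k + a) * (k + b) = (1 + (a - b) / (k + b)) * (k + b) * (k + b).
    by field.
  by rewrite !qcharM -mulrA -[_ * qchar (k + b)]expr2 qchar_sqr // mulr1.
rewrite (eq_bigr _ e).
have ab0 : a - b != 0 by rewrite subr_eq0.
have -> : \sum_(k | k != - b) qchar (1 + (a - b) / (k + b)) =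
          \sum_(k | k != 1) qchar k.
  rewrite [RHS](reindex_onto (fun k => 1 + (a - b) / (k + b))
       (fun y => (a - b) / (y - 1) - b)) /=; last first.
    by move=> y y1; rewrite subrK invf_div mulrC divfK // addrC subrK.
  apply: eq_bigl => k; apply/idP/idP.
    rewrite -addr_eq0 => kb; rewrite -subr_eq0 [1 + _]addrC addrK.
    rewrite mulf_neq0 ?invr_eq0 //=; apply/eqP.
    by rewrite invf_div mulrC divfK // addrK.
  case/andP => + _; apply: contra => /eqP ->.
  by rewrite addNr invr0 mulr0 addr0.
have := sum_qchar; rewrite (bigD1 1) //= qchar1.
by move=> /eqP; rewrite addrC addr_eq0 => /eqP.
Qed.
End QuadraticCharacter.

(** * Cubic twists of the sum of chi (x^3 + 1) *)

Section CubicTwists.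
Variables (F : finFieldType) (m : nat).
Hypothesis cardF : #|F| = (6 * m).+1.

Local Notation chi := (@qchar F (3 * m)).

Fact card_half : #|F| = (2 * (3 * m)).+1.
Proof. by rewrite cardF; lia. Qed.

Definition cubic_sum (k : F) : int := \sum_x chi (x ^+ 3 + k).

(** The factor chi k makes the value depend on the class of k modulo cubes
    only. *)
Definition cubic_twist (k : F) : int := chi k * cubic_sum k.

Definition card_cube_roots (k : F) : int := \sum_(x : F) (x ^+ 3 == k)%:R.

Lemma reindex_mulf (c : F) (f : F -> int) : c != 0 ->
  \sum_x f x = \sum_x f (c * x).
Proof.
move=> c0; rewrite (reindex (fun x => c * x)) //=.
by exists (fun x => c^-1 * x) => x _; rewrite ?mulKf ?mulVKf.
Qed.

Lemma qchar_cube (x : F) : chi (x ^+ 3) = chi x.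
Proof.
have [->|x0] := eqVneq x 0; first by rewrite expr0n.
by rewrite exprS expr2 !(qcharM card_half) -[chi x * chi x]expr2 (qchar_sqr _ x0) mulr1.
Qed.

Lemma cubic_sum0 : cubic_sum 0 = 0.
Proof.
rewrite /cubic_sum -[RHS](sum_qchar card_half); apply: eq_bigr => x _.
by rewrite addr0 qchar_cube.
Qed.

Lemma cubic_sumM (k c : F) : c != 0 -> cubic_sum (k * c ^+ 3) = chi c * cubic_sum k.
Proof.
move=> c0; rewrite /cubic_sum (reindex_mulf _ c0) mulr_sumr.
by apply: eq_bigr => x _; rewrite exprMn [k * _]mulrC -mulrDr (qcharM card_half) qchar_cube.
Qed.

Lemma cubic_twistM (k c : F) : c != 0 -> cubic_twist (k * c ^+ 3) = cubic_twist k.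
Proof.
move=> c0; rewrite /cubic_twist (cubic_sumM _ c0) (qcharM card_half) qchar_cube.
by rewrite -mulrA [chi c * _]mulrA -expr2 (qchar_sqr _ c0) mul1r.
Qed.

Lemma card_cube_rootsM (k c : F) : c != 0 -> card_cube_roots (k * c ^+ 3) = card_cube_roots k.
Proof.
move=> c0; rewrite /card_cube_roots (reindex_mulf _ c0); apply: eq_bigr => x _.
by rewrite exprMn [k * _]mulrC (inj_eq (mulfI _)) // expf_neq0.
Qed.

Section Classes.
Variable g : F.
Hypothesis pg : (6 * m).-primitive_root g.

Lemma prim_root_m_gt0 : (0 < m)%N.
Proof. by have := prim_order_gt0 pg; lia. Qed.

Lemma prim_root_neq0 : g != 0.
Proof. by rewrite (prim_root_eq0 pg); have := prim_root_m_gt0; lia. Qed.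

Lemma sum_cube_classes (f : F -> int) :
    (forall k c, c != 0 -> f (k * c ^+ 3) = f k) ->
  \sum_k f k = f 0 + (2 * m)%:Z * (f 1 + f g + f (g ^+ 2)).
Proof.
move=> fM; rewrite (sum_prim_root cardF _ pg); congr (_ + _).
have -> : (6 * m = 3 * (2 * m))%N by lia.
elim: (2 * m)%N => [|n IHn]; first by rewrite muln0 big_ord0 mul0r.
have -> : (3 * n.+1 = (3 * n).+3)%N by lia.
rewrite !big_ord_recr /= IHn.
have e j : f (g ^+ (j + 3 * n)) = f (g ^+ j).
  by rewrite exprD mulnC exprM fM // expf_neq0 // prim_root_neq0.
have := e 0%N; have := e 1%N; have := e 2%N.
by rewrite !addSn !add0n expr0 expr1 => -> -> ->; lia.
Qed.

Lemma card_cube_roots_eq0 j : (0 < j < 3)%N -> card_cube_roots (g ^+ j) = 0.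
Proof.
move=> j12; rewrite /card_cube_roots big1 // => x _; case: eqP => // xg.
have x0 : x != 0.
  apply/eqP => x0; move: xg; rewrite x0 expr0n /= => /esym/eqP.
  by rewrite expf_eq0 (negbTE prim_root_neq0) andbF.
have : (g ^+ j) ^+ (2 * m) == 1.
  rewrite -xg -exprM; have -> : (3 * (2 * m) = 6 * m)%N by lia.
  by rewrite (expf_unit cardF).
by rewrite -exprM -(prim_order_dvd pg) gtnNdvd //; have := prim_root_m_gt0; nia.
Qed.
End Classes.

Lemma card_cube_roots0 : card_cube_roots 0 = 1.
Proof.
rewrite /card_cube_roots (bigD1 0) //= expr0n eqxx big1 // => x x0.
by rewrite expf_eq0 (negbTE x0).
Qed.

(** Every element has one cube: summing over the classes of k leaves only the
    class of 1, since the other two contain no cubes. *)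
Lemma card_cube_roots1 : card_cube_roots 1 = 3.
Proof.
have [g pg] := exists_prim_root cardF.
have s : \sum_k card_cube_roots k = (6 * m).+1%:Z.
  rewrite /card_cube_roots exchange_big /= (eq_bigr (fun=> 1)).
    by rewrite sumr_const cardF -natz.
  move=> x _; rewrite (bigD1 (x ^+ 3)) //= eqxx big1 ?addr0 // => k.
  by rewrite eq_sym => /negbTE ->.
move: s; rewrite (sum_cube_classes pg card_cube_rootsM) card_cube_roots0.
rewrite -{1}[g]expr1 !(card_cube_roots_eq0 pg) // !addr0.
by have := prim_root_m_gt0 pg; nia.
Qed.

Lemma sum_cubic_twist : \sum_k cubic_twist k = 0.
Proof.
have c k : cubic_twist k = \sum_x chi ((k + 0) * (k + x ^+ 3)).
  rewrite /cubic_twist /cubic_sum mulr_sumr; apply: eq_bigr => x _.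
  by rewrite addr0 (qcharM card_half) [k + _]addrC.
rewrite (eq_bigr _ (fun k _ => c k)) exchange_big /=.
rewrite (eq_bigr (fun x : F => #|F|%:Z * (x ^+ 3 == 0)%:R - 1)); last first.
  by move=> x _; rewrite (sum_qchar_shift card_half) eq_sym PoszM natz.
rewrite sumrB -mulr_sumr -/(card_cube_roots 0) card_cube_roots0 mulr1 sumr_const.
by rewrite natz subrr.
Qed.

Lemma sum_cubic_twist_sqr : \sum_k cubic_twist k ^+ 2 = 2 * #|F|%:Z * (#|F|%:Z - 1).
Proof.
have c k : cubic_twist k ^+ 2 =
    \sum_x \sum_y chi ((k + x ^+ 3) * (k + y ^+ 3)).
  have [->|k0] := eqVneq k 0.
    rewrite /cubic_twist cubic_sum0 mulr0 expr0n /= -[LHS](mul0r (cubic_sum 0)).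
    rewrite -{1}cubic_sum0 /cubic_sum mulr_suml; apply: eq_bigr => x _.
    rewrite mulr_sumr; apply: eq_bigr => y _.
    by rewrite (qcharM card_half) !add0r !addr0.
  rewrite /cubic_twist exprMn (qchar_sqr _ k0) mul1r expr2 /cubic_sum mulr_suml.
  apply: eq_bigr => x _; rewrite mulr_sumr; apply: eq_bigr => y _.
  by rewrite (qcharM card_half) ![k + _]addrC.
rewrite (eq_bigr _ (fun k _ => c k)) exchange_big /=.
have [g pg] := exists_prim_root cardF.
rewrite (eq_bigr (fun x : F => #|F|%:Z * card_cube_roots (x ^+ 3) - #|F|%:Z)); last first.
  move=> x _; rewrite exchange_big /=.
  rewrite (eq_bigr (fun y : F => #|F|%:Z * (y ^+ 3 == x ^+ 3)%:R - 1)); last first.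
    by move=> y _; rewrite (sum_qchar_shift card_half) eq_sym PoszM natz.
  by rewrite sumrB -mulr_sumr sumr_const natz.
rewrite sumrB -mulr_sumr sumr_const (sum_prim_root cardF _ pg) expr0n /= card_cube_roots0.
rewrite (eq_bigr (fun=> 3)); last first.
  move=> i _; rewrite -[(g ^+ i) ^+ 3]mul1r card_cube_rootsM ?card_cube_roots1 //.
  by rewrite expf_neq0 // (prim_root_neq0 pg).
by rewrite sumr_const card_ord cardF -[X in 1 + X]mulr_natr -[X in _ - X]mulr_natr !natz; nia.
Qed.

(** Modulo 2 a character value is its square, so the sum is congruent to the
    number of x with x^3 + 1 nonzero, which is the odd cardinal minus 3. *)
Lemma cubic_sum1_even : exists a, cubic_sum 1 = 2 * a.
Proof.
have /dvdzP[a Ha] : (2 %| \sum_(x : F) (chi (x ^+ 3 + 1)%R - chi (x ^+ 3 + 1)%R ^+ 2)%R)%Z.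
  apply: rpred_sum => x _; rewrite /qchar; case: ifP => // _; by case: ifP.
have e : \sum_x chi (x ^+ 3 + 1) ^+ 2 = #|F|%:Z - 3.
  rewrite -card_cube_roots1 -[card_cube_roots 1](@card_cube_rootsM _ (-1)) ?oppr_eq0 ?oner_neq0 //.
  rewrite mul1r -signr_odd expr1 -[#|F|%:Z]natz -sumr_const -sumrB.
  apply: eq_bigr => x _; rewrite -addr_eq0.
  have [->|/qchar_sqr->//] := eqVneq; by rewrite qchar0.
move: Ha; rewrite sumrB e cardF => Ha.
have [g /prim_root_m_gt0 m0] := exists_prim_root cardF.
exists (a + (3 * m)%:Z - 1); rewrite /cubic_sum.
move/eqP: Ha; rewrite subr_eq => /eqP ->.
lia.
Qed.

(** Nonzero x come in triples with the same cube, so only x = 0 counts. *)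
Lemma cubic_sum1_mod3 : exists c, cubic_sum 1 = 3 * c + 1.
Proof.
have [g pg] := exists_prim_root cardF.
pose f (i : nat) := chi ((g ^+ i) ^+ 3 + 1).
have fper i : f (2 * m + i)%N = f i.
  rewrite /f exprD exprMn -[(g ^+ (2 * m)) ^+ 3]exprM; have -> : (2 * m * 3 = 6 * m)%N by lia.
  by rewrite (prim_expr_order pg) mul1r.
exists (\sum_(i < 2 * m) f i).
rewrite /cubic_sum (sum_prim_root cardF _ pg) expr0n add0r qchar1 addrC; congr (_ + _).
rewrite -[LHS]/(\sum_(i < 6 * m) f i).
have -> : (6 * m = 2 * m + (2 * m + 2 * m))%N by lia.
rewrite big_split_ord /= [X in _ + X]big_split_ord /=.
rewrite [X in _ + (X + _)](eq_bigr (fun i : 'I_ _ => f i)) => [|i _]; last exact: fper.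
rewrite [X in _ + (_ + X)](eq_bigr (fun i : 'I_ _ => f i)) => [|i _]; last by rewrite !fper.
by ring.
Qed.

(** The twists of the sum by the three classes modulo cubes are integers
    adding up to 0 whose squares add up to 6q; such a triple represents 4q, and
    by parity q itself, by the form u^2 + 3 v^2. *)
Lemma cubic_sum_form : exists a e : int,
  cubic_sum 1 = 2 * a /\ #|F|%:Z = a ^+ 2 + 3 * e ^+ 2.
Proof.
have [g pg] := exists_prim_root cardF.
have m0 := prim_root_m_gt0 pg.
have tw1 : cubic_twist 1 = cubic_sum 1 by rewrite /cubic_twist qchar1 mul1r.
have tw0 : cubic_twist 0 = 0 by rewrite /cubic_twist cubic_sum0 mulr0.
have s1 := sum_cubic_twist; have s2 := sum_cubic_twist_sqr.
move: s1 s2; rewrite (sum_cube_classes pg cubic_twistM).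
rewrite (@sum_cube_classes _ pg (fun k => cubic_twist k ^+ 2)); last first.
  by move=> k c c0; rewrite cubic_twistM.
rewrite tw0 tw1.
have [a ->] := cubic_sum1_even.
rewrite expr0n /= !add0r cardF.
set v := cubic_twist g; set w := cubic_twist (g ^+ 2) => s1 s2.
have {}s1 : 2 * a + v + w = 0 by nia.
have {}s2 : (2 * a) ^+ 2 + v ^+ 2 + w ^+ 2 = 6 * (6 * m).+1%:Z by nia.
have d : (v - w) ^+ 2 = 12 * ((6 * m).+1%:Z - a ^+ 2) by nia.
have [e He] : exists e, v - w = 6 * e.
  have /dvdzP[e ->] : (6 %| v - w)%Z.
    have d6 : (6 %| (v - w) ^+ 2)%Z.
      by apply/dvdzP; exists (2 * ((6 * m).+1%:Z - a ^+ 2)); rewrite d; lia.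
    rewrite -[6]/(2%:Z * 3%:Z) Gauss_dvdz //.
    have dv (l : nat) : prime l -> (l %| 6)%N -> (l%:Z %| v - w)%Z.
      move=> pl l6; have : (l%:Z %| (v - w) ^+ 2)%Z by apply: dvdz_trans d6.
      by rewrite !dvdzE abszX Euclid_dvdX // => /andP[].
    by rewrite !dv.
  by exists e; rewrite mulrC.
exists a, e; split=> //; apply: (@mulfI _ 12) => //.
have -> : 12 * (a ^+ 2 + 3 * e ^+ 2) = 12 * a ^+ 2 + (6 * e) ^+ 2 by ring.
by rewrite -He d; ring.
Qed.
End CubicTwists.

(** With two representations, (ad)^2 - (cb)^2 is a multiple of p, hence p
    divides ad + cb or ad - cb; composing the forms shows that this factor
    vanishes. *)
Lemma sqr_form3_uniq (p : nat) (a b c d : int) : prime p ->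
  p%:Z = a ^+ 2 + 3 * b ^+ 2 -> p%:Z = c ^+ 2 + 3 * d ^+ 2 -> a ^+ 2 = c ^+ 2.
Proof.
move=> pp e1 e2.
have p0 : (0 < p%:Z) by rewrite ltz_nat prime_gt0.
have dv : (p%:Z %| (a * d - c * b) * (a * d + c * b))%Z.
  by apply/dvdzP; exists (d ^+ 2 - b ^+ 2); nia.
(* p^2 = (ac -+ 3bd)^2 + 3 (ad +- bc)^2 leaves no room for a nonzero
   multiple of p in the last square. *)
have key (s : int) : s ^+ 2 = 1 -> (p%:Z %| a * d + s * (c * b))%Z ->
    a * d + s * (c * b) = 0.
  move=> s1 /dvdzP[q Hq].
  have id : p%:Z ^+ 2 = (a * c - s * (3 * b * d)) ^+ 2 + 3 * (a * d + s * (c * b)) ^+ 2.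
    rewrite expr2 {1}e1 e2.
    have -> : (a * c - s * (3 * b * d)) ^+ 2 + 3 * (a * d + s * (c * b)) ^+ 2 =
      a ^+ 2 * c ^+ 2 + 9 * s ^+ 2 * b ^+ 2 * d ^+ 2 + 3 * a ^+ 2 * d ^+ 2 +
      3 * s ^+ 2 * c ^+ 2 * b ^+ 2 by ring.
    by rewrite s1; ring.
  suff q0 : q = 0 by rewrite Hq q0 mul0r.
  have h : 3 * q ^+ 2 * p%:Z ^+ 2 <= 1 * p%:Z ^+ 2.
    rewrite mul1r [X in _ <= X]id Hq.
    have := sqr_ge0 (a * c - s * (3 * b * d)); nia.
  by move: h; rewrite ler_pM2r ?exprn_gt0 // expr2; clear; nia.
have : a * d + c * b = 0 \/ a * d - c * b = 0.
  move: dv; rewrite dvdzE abszM Euclid_dvdM // => /orP[] h.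
    by right; have := key (-1) erefl; rewrite mulN1r; apply; rewrite dvdzE.
  by left; have := key 1 erefl; rewrite mul1r; apply; rewrite dvdzE.
move=> h.
have : (a * d) ^+ 2 = (c * b) ^+ 2.
  case: h => /eqP.
    by rewrite addr_eq0 => /eqP ->; rewrite sqrrN.
  by rewrite subr_eq0 => /eqP ->.
have : p%:Z * (b ^+ 2 - d ^+ 2) = (c * b) ^+ 2 - (a * d) ^+ 2.
  by rewrite mulrBr {1}e2 {1}e1; ring.
move=> e3 e4; move: e3; rewrite e4 subrr => /eqP.
rewrite mulf_eq0 gt_eqF //= subr_eq0 => /eqP bd.
by move: e1; rewrite e2 bd => /addIr ->.
Qed.

(** * Binomial sums with harmonic values *)

Section BinomialSums.
Variable F : fieldType.

Definition harm (n : nat) : F := \sum_(i < n) i.+1%:R^-1.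

Lemma harmS n : harm n.+1 = harm n + n.+1%:R^-1.
Proof. by rewrite /harm big_ord_recr. Qed.

Lemma sum_binom_exp n (x : F) :
  \sum_(k < n) 'C(n, k.+1)%:R * (- 1) ^+ k * x ^+ k.+1 = 1 - (1 - x) ^+ n.
Proof.
rewrite exprDn big_ord_recl /= bin0 expr0 mulr1n expr1n mulr1 opprD addrA subrr sub0r -sumrN.
apply: eq_bigr => k _; rewrite expr1n mul1r [in RHS]exprNn -[in RHS]mulr_natl /bump /= add1n !exprS.
by ring.
Qed.

(** The truncated logarithm turns into its reflection x -> 1 - x: passing from
    n to n + 1 adds the same binomial expansion to both sides. *)
Lemma sum_binom_log n (x : F) : (forall i, (0 < i <= n)%N -> (i%:R : F) != 0) ->
  \sum_(k < n) 'C(n, k.+1)%:R * (- 1) ^+ k * x ^+ k.+1 / k.+1%:R =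
  \sum_(k < n) (1 - (1 - x) ^+ k.+1) / k.+1%:R.
Proof.
elim: n => [|n IHn] nz; first by rewrite !big_ord0.
rewrite [RHS]big_ord_recr /= -IHn => [|i /andP[i0 lin]]; last first.
  by apply: nz; rewrite i0 leqW.
rewrite -sum_binom_exp mulr_suml.
have -> : \sum_(k < n) 'C(n, k.+1)%:R * (- 1) ^+ k * x ^+ k.+1 / k.+1%:R =
  \sum_(k < n.+1) 'C(n, k.+1)%:R * (- 1) ^+ k * x ^+ k.+1 / k.+1%:R.
  by rewrite big_ord_recr /= bin_small // !mul0r addr0.
rewrite -big_split /=; apply: eq_bigr => k _.
have k0 : (k.+1%:R : F) != 0 by apply: nz; rewrite /= ltn_ord.
have n0 : (n.+1%:R : F) != 0 by apply: nz; rewrite /= leqnn.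
have e : n.+1%:R * 'C(n, k)%:R = k.+1%:R * 'C(n.+1, k.+1)%:R :> F.
  by rewrite -!natrM mul_bin_diag.
have -> : 'C(n.+1, k.+1)%:R = n.+1%:R * 'C(n, k)%:R / k.+1%:R :> F.
  by rewrite e mulrC mulKf.
have -> : 'C(n, k.+1)%:R = n.+1%:R * 'C(n, k)%:R / k.+1%:R - 'C(n, k)%:R :> F.
  by rewrite e mulrC mulKf // binS natrD addrK.
move: k0 n0; move: (k.+1%:R : F) (n.+1%:R : F) => K N K0 N0.
by field; rewrite K0 N0.
Qed.

(** Both sides satisfy Pascal's recurrence in (a, b); the edge a = 0 is the
    truncated logarithm at x = 1. *)
Lemma alt_sum_binom_harm a b : (forall i, (0 < i <= a + b)%N -> (i%:R : F) != 0) ->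
  \sum_(d < b) (- 1) ^+ d.+1 * 'C(a + b, a + d.+1)%:R / d.+1%:R =
  'C(a + b, a)%:R * (harm a - harm (a + b)).
Proof.
elim: a b => [|a IHa] b nz.
  rewrite add0n bin0 mul1r /harm big_ord0 sub0r -sumrN.
  have := sum_binom_log 1 nz; rewrite add0n subrr => e.
  under [in RHS]eq_bigr => k _ do
    rewrite -[k.+1%:R^-1]mul1r -[X in X / _](subr0 1) -[X in 1 - X](expr0n _ k.+1) /=.
  rewrite sumrN -e -sumrN; apply: eq_bigr => k _.
  by rewrite exprS expr1n mulr1 mulN1r !mulNr [_ * 'C(_, _)%:R]mulrC.
elim: b nz => [|b IHb] nz; first by rewrite big_ord0 addn0 subrr mulr0.
have nz1 i : (0 < i <= a.+1 + b)%N -> (i%:R : F) != 0.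
  by move=> h; apply: nz; lia.
have nz2 i : (0 < i <= a + b.+1)%N -> (i%:R : F) != 0.
  by move=> h; apply: nz; lia.
have -> : \sum_(d < b.+1) (-1) ^+ d.+1 * 'C(a.+1 + b.+1, a.+1 + d.+1)%:R / d.+1%:R =
  \sum_(d < b) (-1) ^+ d.+1 * 'C(a.+1 + b, a.+1 + d.+1)%:R / d.+1%:R +
  \sum_(d < b.+1) (-1) ^+ d.+1 * 'C(a + b.+1, a + d.+1)%:R / d.+1%:R :> F.
  have -> : \sum_(d < b) (-1) ^+ d.+1 * 'C(a.+1 + b, a.+1 + d.+1)%:R / d.+1%:R =
    \sum_(d < b.+1) (-1) ^+ d.+1 * 'C(a.+1 + b, a.+1 + d.+1)%:R / d.+1%:R :> F.
    by rewrite big_ord_recr /= bin_small ?mulr0 ?mul0r ?addr0 // addnS.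
  rewrite -big_split /=; apply: eq_bigr => d _.
  by rewrite addSn addSn binS natrD -addSnnS mulrDr mulrDl.
rewrite IHb // IHa // [(a + b.+1)%N]addnS [(a.+1 + b.+1)%N]addnS addSn !harmS.
rewrite [in RHS]binS natrD.
have s0 : ((a + b).+2%:R : F) != 0 by apply: nz; lia.
have a0 : (a.+1%:R : F) != 0 by apply: nz; lia.
have e : 'C((a + b).+1, a.+1)%:R + 'C((a + b).+1, a)%:R =
   (a + b).+2%:R * 'C((a + b).+1, a)%:R / a.+1%:R :> F.
  by rewrite -natrD -binS -natrM mul_bin_diag natrM mulrC mulKf.
have -> : 'C((a + b).+1, a.+1)%:R =
   (a + b).+2%:R * 'C((a + b).+1, a)%:R / a.+1%:R - 'C((a + b).+1, a)%:R :> F.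
  by rewrite -e addrK.
move: (harm (a + b) + _) => h; move: s0 a0; move: ((a + b).+2%:R : F) (a.+1%:R : F) => K N K0 N0.
by field; rewrite K0 N0.
Qed.

(** Partial fractions: by Pascal's rule the sum at n + 1 is the difference of
    the sums at n for x and x + 1. *)
Lemma alt_sum_binom_frac n (x : F) : (forall i, (i <= n)%N -> x + i%:R != 0) ->
  \sum_(s < n.+1) (- 1) ^+ s * 'C(n, s)%:R / (x + s%:R) =
  n`!%:R / \prod_(i < n.+1) (x + i%:R).
Proof.
elim: n x => [|n IHn] x nz.
  by rewrite big_ord1 big_ord1 expr0 bin0 fact0 !mul1r.
have nzS i : (i <= n)%N -> x + 1 + i%:R != 0.
  by move=> h; rewrite -addrA -(natrD _ 1) add1n nz.
have -> : \sum_(s < n.+2) (-1) ^+ s * 'C(n.+1, s)%:R / (x + s%:R) =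
  \sum_(s < n.+1) (-1) ^+ s * 'C(n, s)%:R / (x + s%:R) -
  \sum_(s < n.+1) (-1) ^+ s * 'C(n, s)%:R / (x + 1 + s%:R) :> F.
  rewrite big_ord_recl /= bin0.
  have -> : \sum_(s < n.+1) (-1) ^+ s * 'C(n, s)%:R / (x + s%:R) =
    \sum_(s < n.+2) (-1) ^+ s * 'C(n, s)%:R / (x + s%:R) :> F.
    by rewrite [RHS]big_ord_recr /= bin_small // mulr0 mul0r addr0.
  rewrite [in RHS]big_ord_recl /= bin0 -addrA; congr (_ + _).
  rewrite -sumrB; apply: eq_bigr => s _.
  rewrite /bump /= !add1n binS natrD exprS -addrA -(natrD _ 1) add1n.
  by rewrite !mulN1r !mulrDr !mulrDl !mulNr.
rewrite !IHn // => [|i h]; last by apply: nz; rewrite leqW.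
pose P := \prod_(i < n) (x + i.+1%:R).
have e1 : \prod_(i < n.+1) (x + i%:R) = x * P.
  by rewrite big_ord_recl /= addr0; congr (_ * _).
have e2 : \prod_(i < n.+1) (x + 1 + i%:R) = P * (x + n.+1%:R).
  rewrite big_ord_recr /= -addrA -(natrD _ 1); congr (_ * _).
  by apply: eq_bigr => i _; rewrite -addrA -(natrD _ 1).
rewrite [in RHS]big_ord_recr /= e1 e2.
have x0 : x != 0 by rewrite -[x]addr0 (nz 0).
have xn : x + n.+1%:R != 0 by rewrite nz.
have P0 : P != 0.
  by apply/prodf_neq0 => i _; rewrite nz // ltnS ltnW // ltn_ord.
rewrite factS natrM.
move: xn P0; move: P {e1 e2} => P + P0.
have -> : (n.+1%:R : F) = x + n.+1%:R - x by rewrite addrC addKr.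
move: (x + n.+1%:R) => K K0.
by field; rewrite P0 K0 x0.
Qed.
End BinomialSums.

(** * Harmonic numbers in characteristic p = 6m + 1 *)

Section CharacteristicP.
Variables (F : fieldType) (m : nat).
Local Notation p := (6 * m).+1.
Hypothesis pch : p \in [pchar F].

Local Notation H := (harm F).

Lemma natf_neq0_lt i : (0 < i < p)%N -> (i%:R : F) != 0.
Proof. by case/andP=> i0 ip; rewrite -(dvdn_pcharf pch) gtnNdvd. Qed.

Lemma natf_reflect i : (i <= p)%N -> ((p - i)%:R : F) = - i%:R.
Proof. by move=> ip; rewrite natrB // (pcharf0 pch) sub0r. Qed.

Lemma pchar_m_gt0 : (0 < m)%N.
Proof. by have := prime_gt1 (pcharf_prime pch); lia. Qed.

Lemma mulf_2_3m : (2 : F) * (3 * m)%:R = -1.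
Proof.
have := pcharf0 pch; rewrite -natrM -add1n natrD => /eqP.
by rewrite addrC addr_eq0 mulnA => /eqP.
Qed.

Lemma harm_diff a b : (a <= b)%N -> H b - H a = \sum_(a <= i < b) i.+1%:R^-1.
Proof.
move=> ab; rewrite /harm -!(big_mkord xpredT (fun i => i.+1%:R^-1)).
by rewrite (@big_cat_nat _ _ _ a 0 b) //= [LHS]addrC addKr.
Qed.

(** The substitution i -> p - i changes the sign of each reciprocal. *)
Lemma harm_reflect k : (k <= 6 * m)%N -> H (6 * m - k) = H k.
Proof.
have m0 := pchar_m_gt0.
have d j : (j <= 6 * m)%N -> H (6 * m) - H j = - H (6 * m - j).
  move=> jp; rewrite harm_diff // /harm -sumrN.
  rewrite -{1}[j]add0n big_addn big_mkord (reindex_inj rev_ord_inj) /=.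
  apply: eq_bigr => i _; rewrite -invrN; congr (_^-1).
  by rewrite -natf_reflect; [congr _%:R; have := ltn_ord i; lia | have := ltn_ord i; lia].
have h0 : H (6 * m) = 0.
  have := d 0%N isT; rewrite subn0 {1}/harm [H 0]/harm big_ord0 subr0 => /eqP.
  rewrite -addr_eq0 -mulr2n -mulr_natl mulf_eq0 => /orP[|/eqP //].
  by rewrite (negbTE (natf_neq0_lt _)) //; lia.
by move=> kp; have := d _ kp; rewrite h0 sub0r => /eqP; rewrite eqr_opp eq_sym => /eqP.
Qed.

Lemma harm_6m : H (6 * m) = 0.
Proof. by rewrite -[(6 * m)%N]subn0 harm_reflect // /harm big_ord0. Qed.

Definition odd_harm n : F := \sum_(i < n) (i.*2.+1)%:R^-1.

Lemma odd_harmE n : odd_harm n = H n.*2 - H n / 2.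
Proof.
elim: n => [|n IHn]; first by rewrite /odd_harm /harm !big_ord0 mul0r subr0.
rewrite /odd_harm big_ord_recr /= -/(odd_harm n) IHn doubleS !harmS.
have -> : (n.*2.+2%:R : F)^-1 = n.+1%:R^-1 / 2.
  by rewrite -doubleS -muln2 natrM invfM.
by move: (n.+1%:R^-1) (n.*2.+1%:R^-1) => y x; ring.
Qed.

(** Split the numbers between 4m and 6m by parity: the even ones are the doubles
    of those between 2m and 3m, the odd ones the reflections p - 2j with
    0 < j <= m, and the whole range reflects to the numbers up to 2m. *)
Lemma harm_trisect : H (2 * m) - H m = - H (3 * m).
Proof.
have m0 := pchar_m_gt0.
have two0 : (2 : F) != 0 by apply: natf_neq0_lt; lia.
have e : odd_harm (3 * m) - odd_harm (2 * m) = - (H m / 2).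
  rewrite /odd_harm -!(big_mkord xpredT (fun i => i.*2.+1%:R^-1)).
  rewrite (@big_cat_nat _ _ _ (2 * m) 0 (3 * m)) //=; last by lia.
  rewrite [LHS]addrC addKr -{1}[(2 * m)%N]add0n big_addn.
  have -> : (3 * m - 2 * m = m)%N by lia.
  rewrite big_mkord (reindex_inj rev_ord_inj) /= /harm mulr_suml -sumrN.
  apply: eq_bigr => i _; rewrite -invfM -invrN -natrM; congr (_^-1).
  by rewrite -natf_reflect; [congr _%:R; have := ltn_ord i; lia | have := ltn_ord i; lia].
move: e; rewrite !odd_harmE.
have -> : (3 * m).*2 = (6 * m)%N by lia.
have -> : (2 * m).*2 = (6 * m - 2 * m)%N by lia.
rewrite harm_6m harm_reflect; last by lia.
move=> e; apply: (mulIf two0); apply/eqP; rewrite -subr_eq0; apply/eqP.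
have -> : (H (2 * m) - H m) * 2 - - H (3 * m) * 2 =
   - (4 : F) * (0 - H (3 * m) / 2 - (H (2 * m) - H (2 * m) / 2) - - (H m / 2)).
  by field.
by rewrite e subrr mulr0.
Qed.

Lemma bin_pred_p k : (k < p)%N -> ('C(6 * m, k)%:R : F) = (- 1) ^+ k.
Proof.
elim: k => [|k IHk] kp; first by rewrite bin0.
have : ('C(p, k.+1)%:R : F) = 0.
  apply/eqP; rewrite -(dvdn_pcharf pch) prime_dvd_bin ?(pcharf_prime pch) //.
by rewrite binS natrD IHk ?(ltnW kp) // exprS mulN1r => /eqP; rewrite addr_eq0 => /eqP.
Qed.

(** Reflections x -> 1 - x and x -> 1/x of the truncated logarithm carry 1/2
    to -1, where it is the difference of the even and the odd terms. *)
Lemma sum_log_half : \sum_(k < 6 * m) (2^-1) ^+ k.+1 / k.+1%:R = - (H (3 * m) / 2) :> F.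
Proof.
have m0 := pchar_m_gt0.
have two0 : (2 : F) != 0 by apply: natf_neq0_lt; lia.
pose f (x : F) := \sum_(k < 6 * m) x ^+ k.+1 / k.+1%:R.
have f1 x : f (1 - x) = f x.
  have := @sum_binom_log F (6 * m) x.
  have nz i : (0 < i <= 6 * m)%N -> (i%:R : F) != 0 by exact: natf_neq0_lt.
  move=> /(_ nz).
  have -> : \sum_(k < 6 * m) 'C(6 * m, k.+1)%:R * (-1) ^+ k * x ^+ k.+1 / k.+1%:R = - f x.
    rewrite /f -sumrN; apply: eq_bigr => k _; rewrite bin_pred_p; last by rewrite ltnS.
    by rewrite exprS mulN1r !mulNr -expr2 sqrr_sign mul1r.
  have -> : \sum_(k < 6 * m) (1 - (1 - x) ^+ k.+1) / k.+1%:R = H (6 * m) - f (1 - x).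
    by rewrite /f /harm -sumrB; apply: eq_bigr => k _; rewrite mulrBl mul1r.
  by rewrite harm_6m sub0r => /eqP; rewrite eqr_opp eq_sym => /eqP.
have fV : f 2^-1 = - (f 2 / 2).
  rewrite /f [LHS](reindex_inj rev_ord_inj) /= mulr_suml -sumrN.
  apply: eq_bigr => i _; have := ltn_ord i => im.
  have -> : (6 * m - i.+1).+1 = (p - i.+1)%N by lia.
  rewrite natf_reflect; last by lia.
  rewrite invrN mulrN; congr (- _); rewrite mulrAC; congr (_ / _).
  apply: (mulIf two0); apply: (mulIf (expf_neq0 (p - i.+1) two0)).
  rewrite divfK // exprVn mulrAC mulVf ?expf_neq0 // mul1r -exprD subnKC; last by lia.
  exact/esym/(pFrobenius_aut_nat pch 2).
have fN1 : f (-1) = H (3 * m).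
  have aux n : \sum_(k < n.*2) (-1 : F) ^+ k.+1 / k.+1%:R = H n / 2 - odd_harm n.
    elim: n => [|n IHn]; first by rewrite /odd_harm /harm !big_ord0 mul0r subr0.
    rewrite doubleS !big_ord_recr /= IHn /odd_harm big_ord_recr /= harmS.
    rewrite !exprS; have -> : (-1 : F) ^+ n.*2 = 1 by rewrite -signr_odd odd_double.
    have -> : (n.*2.+2%:R : F)^-1 = n.+1%:R^-1 / 2.
      by rewrite -doubleS -muln2 natrM invfM.
    by ring.
  rewrite /f; have -> : (6 * m = (3 * m).*2)%N by lia.
  rewrite aux odd_harmE; have -> : (3 * m).*2 = (6 * m)%N by lia.
  by rewrite harm_6m sub0r opprK -mulrDr; field.
have f2 : f 2 = f (-1) by rewrite -[f 2]f1; congr f; ring.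
by rewrite -/(f 2^-1) fV f2 fN1.
Qed.

(** Modulo p the factors a + i of the numerator on the left are the negatives
    of the factors p - a - i on the right. *)
Lemma bin_reflect a j : (a + j < p)%N ->
  ('C(a + j, j)%:R : F) = (- 1) ^+ j * 'C(6 * m - a, j)%:R.
Proof.
elim: j => [|j IHj] ajp; first by rewrite !bin0 mulr1.
have j0 : (j.+1%:R : F) != 0 by apply: natf_neq0_lt; lia.
apply: (mulfI j0); rewrite addnS -natrM -mul_bin_diag natrM IHj; last by lia.
rewrite [RHS]mulrCA -natrM mul_bin_left natrM.
have -> : (6 * m - a - j = p - (a + j).+1)%N by lia.
rewrite natf_reflect ?exprS; last by lia.
by ring.
Qed.

Lemma prod_add1 n : \prod_(i < n) (1 + i%:R) = n`!%:R :> F.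
Proof.
elim: n => [|n IHn]; first by rewrite big_ord0.
by rewrite big_ord_recr /= IHn factS natrM mulrC -(natrD _ 1).
Qed.

Local Notation C := ('C(3 * m, m)%:R : F).

Lemma natf_6m : (6 : F) * m%:R = -1.
Proof. by rewrite -mulf_2_3m !natrM; ring. Qed.

Lemma invf_natf_dvd6m n k : (0 < k)%N -> (k * n = 6 * m)%N -> (n%:R : F)^-1 = - k%:R.
Proof.
move=> k0 kn; have e : (k%:R : F) * n%:R = -1 by rewrite -natrM kn natrM natf_6m.
have n0 : (n%:R : F) != 0.
  by apply/eqP => n0; move/eqP: e; rewrite n0 mulr0 eq_sym oppr_eq0 oner_eq0.
by apply: (mulIf n0); rewrite mulVf // mulNr e opprK.
Qed.

Lemma natf_fact_neq0 n : (n < p)%N -> (n`!%:R : F) != 0.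
Proof.
elim: n => [|n IHn] np; first by rewrite oner_eq0.
by rewrite factS natrM mulf_neq0 ?IHn ?natf_neq0_lt //; lia.
Qed.

Lemma bin_3m_neq0 : C != 0.
Proof.
have m0 := pchar_m_gt0.
have : ((3 * m)`!%:R : F) != 0 by apply: natf_fact_neq0; lia.
by rewrite -(@bin_fact (3 * m) m) ?natrM ?mulf_eq0 ?negb_or => [/andP[]|]//; lia.
Qed.

(** The three sums below are indexed by the three values of k in 1..6m with
    s + k divisible by 2m, for each s < 3m. Here 6m - s = - (s + 1) modulo p. *)
Lemma sum_C_6m : \sum_(s < 3 * m) (- 1) ^+ s * 'C((3 * m).-1, s)%:R / (6 * m - s)%:R = 2 :> F.
Proof.
have m0 := pchar_m_gt0.
have m3 : (3 * m = (3 * m).-1.+1)%N by lia.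
have fE : ((3 * m)`! = 3 * m * (3 * m).-1`!)%N by rewrite [in LHS]m3 factS -m3.
have := @alt_sum_binom_frac F (3 * m).-1 1.
rewrite -m3 prod_add1 fE natrM.
have f0 : ((3 * m).-1`!%:R : F) != 0.
  by apply: natf_fact_neq0; lia.
have -> : ((3 * m).-1`!%:R : F) / ((3 * m)%:R * (3 * m).-1`!%:R) = (3 * m)%:R^-1.
  by rewrite invfM mulrCA divff // mulr1.
move=> e.
have -> : (2 : F) = - (3 * m)%:R^-1 by rewrite (@invf_natf_dvd6m (3 * m) 2) ?opprK //; lia.
rewrite -e => [|i im]; last first.
  by rewrite -(natrD _ 1) natf_neq0_lt //; lia.
rewrite -sumrN; apply: eq_bigr => s _; have := ltn_ord s => sm.
have -> : (6 * m - s = p - s.+1)%N by lia.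
by rewrite natf_reflect ?invrN ?mulrN -?(natrD _ 1) //; lia.
Qed.

(** Partial fractions at x = -4m give the inverse of binomial(4m, m), which
    reflects into C. *)
Lemma sum_C_4m : \sum_(s < 3 * m) (- 1) ^+ s * 'C((3 * m).-1, s)%:R / (4 * m - s)%:R = 2 / C.
Proof.
have m0 := pchar_m_gt0.
have m3 : (3 * m = (3 * m).-1.+1)%N by lia.
have fE : ((3 * m)`! = 3 * m * (3 * m).-1`!)%N by rewrite [in LHS]m3 factS -m3.
have := @alt_sum_binom_frac F (3 * m).-1 (- (4 * m)%:R); rewrite -m3.
have ne i : (i < 3 * m)%N -> - (4 * m)%:R + i%:R = - (4 * m - i)%:R :> F.
  by move=> im; rewrite natrB ?opprB 1?addrC //; lia.
have -> : \prod_(i < 3 * m) (- (4 * m)%:R + i%:R) =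
    (-1) ^+ (3 * m) * ('C(4 * m, 3 * m) * (3 * m)`!)%:R :> F.
  rewrite bin_ffact ffact_prod natr_prod -[X in _ ^+ X]card_ord -prodrN.
  by apply: eq_bigr => i _; rewrite ne.
have -> : 'C(4 * m, 3 * m) = 'C(3 * m + m, m).
  by rewrite -bin_sub; [congr 'C(_, _); lia | lia].
rewrite [('C(_, _) * _)%:R]natrM bin_reflect; last by lia.
have -> : (6 * m - 3 * m = 3 * m)%N by lia.
have -> : (-1) ^+ (3 * m) = (-1) ^+ m :> F.
  have -> : (3 * m = m + m.*2)%N by lia.
  by rewrite exprD -[X in _ * X]signr_odd odd_double mulr1.
rewrite !mulrA -expr2 sqrr_sign mul1r fE [(_ * _`!)%:R]natrM.
have f0 : ((3 * m).-1`!%:R : F) != 0.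
  by apply: natf_fact_neq0; lia.
have c0 := bin_3m_neq0.
have -> : (3 * m).-1`!%:R / (C * ((3 * m)%:R * (3 * m).-1`!%:R)) = - (2 / C).
  rewrite !invfM mulrC -!mulrA mulVf // mulr1.
  by rewrite (@invf_natf_dvd6m (3 * m) 2) //; [rewrite mulrN mulrC | lia].
move=> /(_ _)/esym e; rewrite -[RHS]opprK e => [|i im]; last first.
  by rewrite ne ?oppr_eq0 ?natf_neq0_lt //; lia.
rewrite -sumrN; apply: eq_bigr => s _.
by rewrite ne // invrN mulrN opprK.
Qed.

(** For s >= 2m one has 8m - s = - (s - 2m + 1) modulo p. Counted outwards from
    the break at 2m, each of the two halves is a sum with harmonic values. *)
Lemma sum_C_2m :
  \sum_(s < 3 * m) (- 1) ^+ s * 'C((3 * m).-1, s)%:R /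
    (if (s < 2 * m)%N then 2 * m - s else 8 * m - s)%N%:R =
  C * (H m / 3 + 2 / 3 * H (2 * m) - H (3 * m) + 2).
Proof.
have m0 := pchar_m_gt0.
have three0 : (3 : F) != 0 by apply: natf_neq0_lt; lia.
have nz a b : (a + b < p)%N -> forall i, (0 < i <= a + b)%N -> (i%:R : F) != 0.
  by move=> h i hi; apply: natf_neq0_lt; lia.
rewrite -(big_mkord xpredT (fun s => (- 1) ^+ s * 'C((3 * m).-1, s)%:R /
    (if (s < 2 * m)%N then 2 * m - s else 8 * m - s)%N%:R : F)).
rewrite (@big_cat_nat _ _ _ (2 * m) 0 (3 * m)) //=; last by lia.
have -> : \sum_(0 <= s < 2 * m) (- 1) ^+ s * 'C((3 * m).-1, s)%:R /
    (if (s < 2 * m)%N then 2 * m - s else 8 * m - s)%N%:R =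
  'C(m.-1 + 2 * m, m.-1)%:R * (H m.-1 - H (m.-1 + 2 * m)) :> F.
  rewrite -alt_sum_binom_harm; last by apply: nz; lia.
  rewrite big_mkord (reindex_inj rev_ord_inj) /=; apply: eq_bigr => e _.
  have := ltn_ord e => em.
  have -> : (2 * m - e.+1 < 2 * m)%N by lia.
  have -> : (2 * m - (2 * m - e.+1) = e.+1)%N by lia.
  have -> : (3 * m).-1 = (m.-1 + 2 * m)%N by lia.
  rewrite -[in LHS]bin_sub; last by lia.
  have -> : (m.-1 + 2 * m - (2 * m - e.+1) = m.-1 + e.+1)%N by lia.
  congr (_ * _ / _); rewrite -signr_odd -[RHS]signr_odd; congr (_ ^+ nat_of_bool _).
  by lia.
have -> : \sum_(2 * m <= s < 3 * m) (- 1) ^+ s * 'C((3 * m).-1, s)%:R /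
    (if (s < 2 * m)%N then 2 * m - s else 8 * m - s)%N%:R =
  'C((2 * m).-1 + m, (2 * m).-1)%:R * (H (2 * m).-1 - H ((2 * m).-1 + m)) :> F.
  rewrite -alt_sum_binom_harm; last by apply: nz; lia.
  rewrite -{1}[(2 * m)%N]add0n big_addn; have -> : (3 * m - 2 * m = m)%N by lia.
  rewrite big_mkord; apply: eq_bigr => d _; have := ltn_ord d => dm.
  have -> : (d + 2 * m < 2 * m)%N = false by lia.
  have -> : (8 * m - (d + 2 * m) = p - d.+1)%N by lia.
  have -> : (3 * m).-1 = ((2 * m).-1 + m)%N by lia.
  have -> : (d + 2 * m = (2 * m).-1 + d.+1)%N by lia.
  rewrite natf_reflect; last by lia.
  rewrite invrN mulrN -!mulNr exprD -signr_odd; have -> : odd (2 * m).-1 by lia.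
  by rewrite expr1 mulN1r opprK.
have -> : (m.-1 + 2 * m = (3 * m).-1)%N by lia.
have -> : ((2 * m).-1 + m = (3 * m).-1)%N by lia.
have hp n : (0 < n)%N -> H n.-1 = H n - n%:R^-1.
  by case: n => // n _; rewrite harmS addrK.
rewrite !hp; try lia.
rewrite (@invf_natf_dvd6m m 6) // (@invf_natf_dvd6m (2 * m) 3); try lia.
rewrite (@invf_natf_dvd6m (3 * m) 2); try lia.
have b n : (0 < n <= 3 * m)%N ->
   'C((3 * m).-1, n.-1)%:R = n%:R * 'C(3 * m, n)%:R / (3 * m)%:R :> F.
  case: n => // n nm; have m30 : ((3 * m)%:R : F) != 0 by apply: natf_neq0_lt; lia.
  rewrite -natrM; have -> : (3 * m = (3 * m).-1.+1)%N by lia.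
  rewrite -mul_bin_diag natrM mulrC mulKf //.
  by have <- : (3 * m = (3 * m).-1.+1)%N by lia.
rewrite !b; try lia.
rewrite -['C(3 * m, 2 * m)]bin_sub; last by lia.
have -> : (3 * m - 2 * m = m)%N by lia.
rewrite !(natrM _ _ m).
have M0 : (m%:R : F) != 0 by apply: natf_neq0_lt; lia.
by field; rewrite M0 three0.
Qed.

(** Exactly one i < n completes s to a multiple of n. *)
Lemma sum_dvd_complement (f : nat -> F) n s : (0 < n)%N ->
  \sum_(i < n | (n %| s + i.+1)%N) f i = f (n - (s %% n).+1)%N.
Proof.
move=> n0; have sn := ltn_pmod s n0.
have lt : (n - (s %% n).+1 < n)%N by lia.
rewrite (big_pred1 (Ordinal lt)) // => i /=; have := ltn_ord i => im.
rewrite {1}(divn_eq s n) -addnA dvdn_addr ?dvdn_mull //.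
apply/idP/eqP => [/dvdnP[q e]|->]; last first.
  by have -> : (s %% n + (Ordinal lt).+1 = n)%N by rewrite /=; lia.
apply: val_inj => /=.
suff : q = 1%N by move=> q1; move: e; rewrite q1; lia.
by move: sn im e; move: (s %% n)%N (i : nat) => r j; nia.
Qed.

Lemma sum_inv_dvd s : (s < 3 * m)%N ->
  \sum_(k < 6 * m | (2 * m %| s + k.+1)%N) k.+1%:R^-1 =
  (6 * m - s)%:R^-1 + (4 * m - s)%:R^-1 +
  (if (s < 2 * m)%N then 2 * m - s else 8 * m - s)%N%:R^-1 :> F.
Proof.
move=> sm; have m0 : (0 < 2 * m)%N by have := pchar_m_gt0; lia.
have block j : \sum_(i < 2 * m | (2 * m %| s + (2 * m * j + i).+1)%N) (2 * m * j + i).+1%:R^-1 =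
    (2 * m * j + (2 * m - s %% (2 * m)))%:R^-1 :> F.
  rewrite (eq_bigl (fun i : 'I__ => 2 * m %| s + i.+1)%N) => [|i]; last first.
    by rewrite -addnS addnCA dvdn_addr // dvdn_mulr.
  rewrite (sum_dvd_complement (fun i => (2 * m * j + i).+1%:R^-1)) //.
  by congr (_%:R^-1); have := ltn_pmod s m0; lia.
have -> : \sum_(k < 6 * m | (2 * m %| s + k.+1)%N) k.+1%:R^-1 =
    \sum_(k < 2 * m + (2 * m + 2 * m) | (2 * m %| s + k.+1)%N) k.+1%:R^-1 :> F.
  by have -> : (6 * m = 2 * m + (2 * m + 2 * m))%N by lia.
rewrite big_split_ord /= [X in _ + X]big_split_ord /=.
have := block 0%N; have := block 1%N; have := block 2%N.
rewrite muln0 muln1 => b2 b1 b0.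
have -> : \sum_(i < 2 * m | (2 * m %| s + i.+1)%N) i.+1%:R^-1 =
    (0 + (2 * m - s %% (2 * m)))%:R^-1 :> F by exact: b0.
have -> : \sum_(i < 2 * m | (2 * m %| s + (2 * m + i).+1)%N) (2 * m + i).+1%:R^-1 =
    (2 * m + (2 * m - s %% (2 * m)))%:R^-1 :> F by exact: b1.
have -> : \sum_(i < 2 * m | (2 * m %| s + (2 * m + (2 * m + i)).+1)%N) (2 * m + (2 * m + i)).+1%:R^-1 =
    (2 * m * 2 + (2 * m - s %% (2 * m)))%:R^-1 :> F.
  have e (i : 'I_(2 * m)) : (2 * m + (2 * m + i) = 2 * m * 2 + i)%N by lia.
  by rewrite -b2; apply: eq_big => i *; rewrite e.
case: ifP => s2.
  rewrite modn_small //.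
  have -> : (0 + (2 * m - s) = 2 * m - s)%N by lia.
  have -> : (2 * m + (2 * m - s) = 4 * m - s)%N by lia.
  have -> : (2 * m * 2 + (2 * m - s) = 6 * m - s)%N by lia.
  by rewrite addrC [X in X + _]addrC.
have -> : (s %% (2 * m) = s - 2 * m)%N.
  have {1}-> : (s = s - 2 * m + 2 * m)%N by lia.
  by rewrite modnDr modn_small //; lia.
have -> : (0 + (2 * m - (s - 2 * m)) = 4 * m - s)%N by lia.
have -> : (2 * m + (2 * m - (s - 2 * m)) = 6 * m - s)%N by lia.
have -> : (2 * m * 2 + (2 * m - (s - 2 * m)) = 8 * m - s)%N by lia.
by rewrite addrCA addrA.
Qed.

Lemma sum_bin_inv_dvd :
  \sum_(s < 3 * m) (- 1) ^+ s * 'C((3 * m).-1, s)%:R *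
    (\sum_(k < 6 * m | (2 * m %| s + k.+1)%N) k.+1%:R^-1) =
  2 + 2 / C + C * (H m / 3 + 2 / 3 * H (2 * m) - H (3 * m) + 2) :> F.
Proof.
under eq_bigr => s _ do rewrite sum_inv_dvd // !mulrDr.
by rewrite !big_split /= sum_C_6m sum_C_4m sum_C_2m.
Qed.
End CharacteristicP.

(** * Contiguity of the truncated hypergeometric sum *)

Section Contiguity.
Variables (R : comNzRingType) (w : nat -> R).

(** The product (a - k + 1) ... (a + k) of 2k consecutive factors, paired so that
    it is symmetric under a -> -1 - a; at a = -1/3 it is, up to the sign
    (-1)^k, the product of the rising factorials of 1/3 and 2/3. *)
Definition sym_rising (k : nat) (a : R) : R :=
  \prod_(i < k) ((a - i%:R) * (a + 1 + i%:R)).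

Definition hyper_sum (n : nat) (a : R) : R := \sum_(k < n) sym_rising k a * w k.

Lemma sym_risingS k a :
  sym_rising k.+1 a = sym_rising k a * ((a - k%:R) * (a + 1 + k%:R)).
Proof. by rewrite /sym_rising big_ord_recr. Qed.

Lemma sym_rising_add1 k a :
  sym_rising k.+1 (a + 1) = sym_rising k a * ((a + k%:R + 1) * (a + k%:R + 2)).
Proof.
elim: k => [|k IHk]; first by rewrite sym_risingS /sym_rising !big_ord0; ring.
by rewrite sym_risingS IHk sym_risingS -[k.+1]addn1 natrD; ring.
Qed.

Lemma sym_rising_sub1 k a :
  sym_rising k.+1 (a - 1) = sym_rising k a * ((a - k%:R - 1) * (a - k%:R)).
Proof.
elim: k => [|k IHk]; first by rewrite sym_risingS /sym_rising !big_ord0; ring.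
by rewrite sym_risingS IHk sym_risingS -[k.+1]addn1 natrD; ring.
Qed.

(** The three-term relation between contiguous Legendre functions at the
    argument 0, where the middle term drops out; truncation leaves the boundary
    term on the right. *)
Lemma hyper_sum_contiguous n a : w 0%N = 1 ->
    (forall k, (k < n)%N -> w k = - 2 * k.+1%:R ^+ 2 * w k.+1) ->
  (a + 1) * hyper_sum n.+1 (a + 1) + a * hyper_sum n.+1 (a - 1) =
  (2 * a + 1) * sym_rising n a * w n.
Proof.
move=> w0; elim: n => [|n IHn] wS.
  by rewrite /hyper_sum !big_ord1 /sym_rising !big_ord0 w0; ring.
rewrite /hyper_sum big_ord_recr [X in a * X]big_ord_recr /= -!/(hyper_sum _ _).
rewrite !mulrDr addrACA IHn => [|k kn]; last by rewrite wS // ltnW.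
rewrite sym_rising_add1 sym_rising_sub1 sym_risingS (wS n) // -[n.+1]addn1 natrD.
by ring.
Qed.
End Contiguity.

(** * Rings in which p^2 = 0 *)

Lemma exprD_sqr0 (R : comPzRingType) (a d : R) n : d ^+ 2 = 0 ->
  (a + d) ^+ n = a ^+ n + a ^+ n.-1 * d *+ n.
Proof.
move=> d2; elim: n => [|n IHn]; first by rewrite mulr0n addr0.
have z : d * (a ^+ n.-1 * d *+ n) = 0.
  by rewrite mulrnAr mulrCA -expr2 d2 mulr0 mul0rn.
rewrite exprS IHn mulrDl !mulrDr z addr0 -exprS -addrA; congr (_ + _).
case: n {IHn z} => [|n] /=; first by rewrite mulr0n mulr0 add0r mulrC.
by rewrite mulrnAr mulrA -exprS [d * _]mulrC -mulrSr.
Qed.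

Lemma exprD1_ends (R : comNzRingType) (X : R) n :
  (1 + X) ^+ n.+1 = 1 + X ^+ n.+1 + \sum_(k < n) 'C(n.+1, k.+1)%:R * X ^+ k.+1.
Proof.
rewrite exprDn big_ord_recl /= bin0 mulr1n expr1n mul1r expr0 -addrA; congr (_ + _).
rewrite big_ord_recr /= addrC; congr (_ + _).
  by rewrite /bump /= add1n subnn expr0 mul1r binn.
by apply: eq_bigr => k _; rewrite /bump /= add1n expr1n mul1r mulr_natl.
Qed.

Section SquareZero.
Variables (p : nat) (R : comUnitRingType).
Hypotheses (pp : prime p) (sqr_p0 : p%:R ^+ 2 = 0 :> R).

(** From u n = 1 + v p one gets an inverse of n, as (1 + v p)(1 - v p) = 1. *)
Lemma unit_natr n : coprime n p -> (n%:R : R) \is a GRing.unit.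
Proof.
case: n => [|n]; first by rewrite /coprime gcd0n => /eqP p1; move: (pp); rewrite p1.
move=> cop; have := egcdnP p (ltn0Sn n); case=> u v e _.
have {}e : (u * n.+1 = v * p + 1)%N by rewrite e (eqP cop).
have h : (u%:R * n.+1%:R) * (1 - v%:R * p%:R) = 1 :> R.
  rewrite -natrM e natrD natrM.
  have -> : (v%:R * p%:R + 1) * (1 - v%:R * p%:R) = 1 - v%:R ^+ 2 * p%:R ^+ 2 :> R.
    by ring.
  by rewrite sqr_p0 mulr0 subr0.
by apply/unitrP; exists (u%:R * (1 - v%:R * p%:R)); split; rewrite -[RHS]h; ring.
Qed.

(** Multiplication by p kills multiples of p, so it factors through F_p and
    carries identities of that field to R. *)
Definition mulp (z : 'F_p) : R := p%:R * (z : nat)%:R.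

Lemma mulp_nat n : mulp n%:R = p%:R * n%:R.
Proof.
rewrite /mulp val_Fp_nat // [in RHS](divn_eq n p) natrD natrM mulrDr.
by rewrite [_ * p%:R]mulrC mulrA -expr2 sqr_p0 mul0r add0r.
Qed.

Lemma natr_Fp_val (z : 'F_p) : (z : nat)%:R = z.
Proof. exact: natr_Zp. Qed.

Lemma mulpB_subproof : zmod_morphism mulp.
Proof.
have D x y : mulp (x + y) = mulp x + mulp y.
  by rewrite -[x]natr_Fp_val -[y]natr_Fp_val -natrD !mulp_nat natrD mulrDr.
have N y : mulp (- y) = - mulp y.
  apply/eqP; rewrite -addr_eq0 -D addNr -[0]/(0%:R) mulp_nat mulr0 //.
by move=> x y; rewrite D N.
Qed.
HB.instance Definition _ := GRing.isZmodMorphism.Build 'F_p R mulp mulpB_subproof.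

Lemma mulp1 : mulp 1 = p%:R.
Proof. by rewrite -[1]/(1%:R) mulp_nat mulr1. Qed.

Lemma mulpM z n : mulp z * n%:R = mulp (z * n%:R).
Proof. by rewrite -[z]natr_Fp_val -natrM !mulp_nat natrM mulrA. Qed.

Lemma mulp_mul0 y z : mulp y * mulp z = 0.
Proof. by rewrite /mulp mulrACA -expr2 sqr_p0 mul0r. Qed.

Lemma natf_coprime n : coprime n p -> (n%:R : 'F_p) != 0.
Proof. by move=> c; rewrite -(dvdn_pcharf (pchar_Fp pp)) -prime_coprime // coprime_sym. Qed.

Lemma exprp_add (a z : R) : (a + p%:R * z) ^+ p = a ^+ p.
Proof.
rewrite exprD_sqr0; last by rewrite exprMn sqr_p0 mul0r.
rewrite -[X in _ + X]mulr_natr.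
have -> : a ^+ p.-1 * (p%:R * z) * p%:R = a ^+ p.-1 * z * p%:R ^+ 2 by ring.
by rewrite sqr_p0 mulr0 addr0.
Qed.

(** The p-th power of any lift of z is its Teichmueller representative
    modulo p^2. *)
Definition teich (z : 'F_p) : R := (z : nat)%:R ^+ p.

Lemma teich_nat n : teich n%:R = n%:R ^+ p.
Proof.
rewrite /teich val_Fp_nat // [in RHS](divn_eq n p) natrD natrM.
by rewrite [(n %/ p)%:R * _]mulrC [X in _ = X ^+ _]addrC exprp_add.
Qed.

Lemma teichM : {morph teich : x y / x * y}.
Proof.
by move=> x y; rewrite -[x]natr_Fp_val -[y]natr_Fp_val -natrM !teich_nat natrM exprMn.
Qed.

Lemma teich1 : teich 1 = 1.
Proof. by rewrite -[1]/(1%:R) teich_nat expr1n. Qed.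

Lemma teich0 : teich 0 = 0.
Proof. by rewrite -[0]/(0%:R) teich_nat expr0n; case: p pp. Qed.

Lemma teichX x n : teich (x ^+ n) = teich x ^+ n.
Proof. by elim: n => [|n IHn]; rewrite ?teich1 // !exprS teichM IHn. Qed.

Lemma teichN1 : odd p -> teich (- 1) = - 1.
Proof.
move=> op; have -> : -1 = p.-1%:R :> 'F_p.
  apply/eqP; rewrite eq_sym -addr_eq0 natr1 prednK ?prime_gt0 //.
  by rewrite (pcharf0 (pchar_Fp pp)).
rewrite teich_nat -subn1 natrB ?prime_gt0 // addrC -[p%:R in LHS]mulr1 exprp_add.
by rewrite -signr_odd op.
Qed.

Lemma expfp (x : 'F_p) : x ^+ p = x.
Proof. by have := expf_card x; rewrite card_Fp. Qed.

Lemma teich_expp x : teich x ^+ p = teich x.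
Proof. by rewrite -teichX expfp. Qed.

Lemma teich_add1X x n : teich (x ^+ n + 1) = (1 + teich x ^+ n) ^+ p.
Proof.
rewrite /teich -!natrX [1 + _](_ : _ = (1 + (x ^ p) ^ n)%:R); last by rewrite natrD.
rewrite -[RHS]teich_nat natrD !natrX natr_Fp_val expfp addrC.
by [].
Qed.

Lemma sub_teich_unit x : x != 1 -> 1 - teich x \is a GRing.unit.
Proof.
have [-> _|x0 x1] := eqVneq x 0; first by rewrite teich0 subr0 unitr1.
have v0 : (0 < (x : nat))%N by rewrite lt0n; apply: contra x0 => /eqP h; apply/eqP/val_inj.
have e : ((x : nat) ^ p - 1)%:R = x - 1 :> 'F_p.
  by rewrite natrB ?expn_gt0 ?v0 // natrX natr_Fp_val expfp.
rewrite /teich -natrX -opprB unitrN -(@natrB _ _ 1) ?expn_gt0 ?v0 //.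
apply: unit_natr; rewrite coprime_sym prime_coprime // (dvdn_pcharf (pchar_Fp pp)) e.
by rewrite subr_eq0.
Qed.

(** Multiplying all points by a generator g multiplies the sum by the n-th
    power of its representative, and 1 minus that power is a unit unless
    p - 1 divides n. *)
Lemma sum_teichX n : (0 < n)%N ->
  \sum_x teich x ^+ n = if (p.-1 %| n)%N then p%:R - 1 else 0.
Proof.
move=> n0; have cF : #|'F_p| = p.-1.+1 by rewrite card_Fp // prednK ?prime_gt0.
have [g pg] := exists_prim_root cF.
have g0 : g != 0.
  by rewrite (prim_root_eq0 pg) -lt0n; have := prime_gt1 pp; case: p => [|[]].
case: ifP => [dn|ndn].
  rewrite (bigD1 0) //= teich0 expr0n (gtn_eqF n0) add0r (eq_bigr (fun=> 1)).
    by rewrite sumr_const cardC1 cF /= -subn1 natrB ?prime_gt0.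
  move=> x x0; rewrite -teichX -(divnK dn) mulnC exprM (expf_unit cF) // expr1n.
  exact: teich1.
have gn1 : g ^+ n != 1 by rewrite -(prim_order_dvd pg) ndn.
apply: (mulrI (sub_teich_unit gn1)); rewrite mulr0 mulrBl mul1r mulr_sumr.
apply/eqP; rewrite subr_eq0; apply/eqP.
rewrite [LHS](reindex (fun x => g * x)) /=; last first.
  by exists (fun x => g^-1 * x) => x _; rewrite ?mulKf ?mulVKf.
by apply: eq_bigr => x _; rewrite teichM exprMn teichX.
Qed.

Section SixM.
Variable m : nat.
Hypothesis pE : p = (6 * m).+1.

Lemma pcharFp6 : (6 * m).+1 \in [pchar 'F_p].
Proof. by rewrite -pE pchar_Fp. Qed.

Lemma cardFp6 : #|'F_p| = (6 * m).+1.
Proof. by rewrite card_Fp. Qed.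

Lemma odd_p6 : odd p.
Proof. by rewrite pE; lia. Qed.

Lemma mulpN z : mulp (- z) = - mulp z.
Proof. exact: raddfN. Qed.

Lemma mulpD y z : mulp (y + z) = mulp y + mulp z.
Proof. exact: raddfD. Qed.

Lemma qchar_teich (y : 'F_p) : (qchar (3 * m) y)%:~R = teich y ^+ (3 * m) :> R.
Proof.
have := qchar_exp (card_half cardFp6) y; rewrite -teichX.
rewrite /qchar; case: (y == 0) => [<-|]; first by rewrite teich0.
case: (_ == 1) => <-; first by rewrite teich1.
by rewrite rmorphN rmorph1 teichN1 ?odd_p6 // rmorphN.
Qed.

Lemma natr_bin_p k : (k < 6 * m)%N ->
  'C(p, k.+1)%:R = mulp ((- 1) ^+ k / k.+1%:R) :> R.
Proof.
move=> km; have c : coprime k.+1 p.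
  by rewrite coprime_sym prime_coprime // gtnNdvd // pE; lia.
apply: (mulIr (unit_natr c)); rewrite mulpM divfK ?natf_coprime //.
rewrite -(bin_pred_p pcharFp6); last by lia.
rewrite mulp_nat -!natrM mulnC; congr _%:R.
by rewrite pE mul_bin_diag.
Qed.

(** The correction term is p times the truncated logarithm of 1 + X. *)
Lemma exprD1_p (X : R) : X ^+ p = X ->
  (1 + X) ^+ p = 1 + X + \sum_(k < 6 * m) mulp ((- 1) ^+ k / k.+1%:R) * X ^+ k.+1.
Proof.
move=> Xp; have := exprD1_ends X (6 * m); rewrite -pE Xp => ->.
by congr (_ + _); apply: eq_bigr => k _; rewrite natr_bin_p.
Qed.

Lemma mulp_3m z : mulp z *+ (3 * m) = mulp (- (z / 2)).
Proof.
have two0 : (2 : 'F_p) != 0 by apply: (natf_neq0_lt pcharFp6); have := pchar_m_gt0 pcharFp6; lia.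
rewrite -[LHS]mulr_natr mulpM -mulrN; congr mulp; congr (_ * _).
apply: (mulfI two0); rewrite (mulf_2_3m pcharFp6) mulrN divff //.
Qed.

Local Notation C := 'C(3 * m, m).
Local Notation H := (harm 'F_p).

Lemma sum_teich_cube n : (0 < n)%N ->
  \sum_x (teich x ^+ 3) ^+ n = if (2 * m %| n)%N then p%:R - 1 else 0.
Proof.
move=> n0; rewrite (eq_bigr (fun x => teich x ^+ (3 * n))) => [|x _]; last by rewrite exprM.
rewrite sum_teichX ?muln_gt0 // pE /=; have -> : (6 * m = 3 * (2 * m))%N by lia.
by rewrite dvdn_pmul2l.
Qed.

(** Expanding ((1 + X)^p)^(3m) to first order in p at X = teich x ^ 3, the main
    part (1 + X)^(3m) contributes p + (p - 1) C, and the correction the sum of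
    sum_bin_inv_dvd; the factor 3m is -1/2 modulo p. *)
Lemma cubic_sum_lift :
  (cubic_sum m (1 : 'F_p))%:~R =
  - C%:R - mulp (C%:R^-1 + C%:R * (H m / 6 + H (2 * m) / 3 - H (3 * m) / 2)) :> R.
Proof.
have m0 := pchar_m_gt0 pcharFp6.
have two0 : (2 : 'F_p) != 0 by apply: (natf_neq0_lt pcharFp6); lia.
have three0 : (3 : 'F_p) != 0 by apply: (natf_neq0_lt pcharFp6); lia.
have six0 : (6 : 'F_p) != 0 by apply: (natf_neq0_lt pcharFp6); lia.
pose X x := teich x ^+ 3.
pose D x := \sum_(k < 6 * m) mulp ((- 1) ^+ k / k.+1%:R) * X x ^+ k.+1.
have D2 x : D x ^+ 2 = 0.
  rewrite expr2 /D mulr_suml big1 // => i _; rewrite mulr_sumr big1 // => j _.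
  by rewrite mulrACA mulp_mul0 mul0r.
have e x : (qchar (3 * m) (x ^+ 3 + 1))%:~R =
    (1 + X x) ^+ (3 * m) + (1 + X x) ^+ (3 * m).-1 * D x *+ (3 * m).
  rewrite qchar_teich teich_add1X exprD1_p; last by rewrite /X -exprM mulnC exprM teich_expp.
  by rewrite exprD_sqr0 //; exact: D2.
rewrite /cubic_sum rmorph_sum /= (eq_bigr _ (fun x _ => e x)) big_split /=.
have -> : \sum_x (1 + X x) ^+ (3 * m) = p%:R + C%:R * (p%:R - 1).
  under eq_bigr => x _ do rewrite exprDn big_ord_recl /= expr1n mul1r expr0 bin0.
  rewrite big_split /= sumr_const card_Fp //; congr (_ + _).
  rewrite exchange_big /=.
  have sm : ((2 * m).-1 < 3 * m)%N by lia.
  rewrite (bigD1 (Ordinal sm)) //= [X in _ + X]big1 => [|s /eqP sne]; last first.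
    under eq_bigr => x _ do rewrite expr1n mul1r /bump /= add1n.
    rewrite sumrMnl /X sum_teich_cube // ifF ?mul0rn //.
    apply/negP => /dvdnP[q qe]; apply: sne; apply: val_inj => /=.
    by have := ltn_ord s; case: q qe => [|[|q]]; rewrite ?mulSn; lia.
  under eq_bigr => x _ do rewrite expr1n mul1r /bump /= add1n.
  rewrite sumrMnl /X sum_teich_cube // addr0 prednK; last by lia.
  rewrite dvdnn mulr_natl; congr (_ *+ _).
  by rewrite -bin_sub; [congr 'C(_, _); lia | lia].
have -> : \sum_x (1 + X x) ^+ (3 * m).-1 * D x *+ (3 * m) =
   mulp (- ((\sum_(s < 3 * m) (- 1) ^+ s * 'C((3 * m).-1, s)%:R *
    (\sum_(k < 6 * m | (2 * m %| s + k.+1)%N) k.+1%:R^-1)) / 2)).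
  rewrite sumrMnl -mulp_3m; congr (_ *+ _).
  have m3 : (3 * m = (3 * m).-1.+1)%N by lia.
  under eq_bigr => x _ do rewrite exprDn -m3 /D mulr_suml.
  rewrite exchange_big /= raddf_sum; apply: eq_bigr => s _.
  under eq_bigr => x _ do rewrite mulr_sumr.
  rewrite exchange_big /= mulr_sumr raddf_sum [RHS]big_mkcond; apply: eq_bigr => k _ /=.
  rewrite (eq_bigr (fun x => mulp ((-1) ^+ k / k.+1%:R) * 'C((3 * m).-1, s)%:R * X x ^+ (s + k.+1))); last first.
    by move=> x _; rewrite expr1n mul1r -mulr_natl exprD; ring.
  rewrite -mulr_sumr /X sum_teich_cube ?addnS //.
  case: ifP => [d|]; last by rewrite mulr0.
  rewrite mulpM mulrBr mulr1 -[p%:R]mulp1 mulp_mul0 sub0r -mulpN; congr mulp.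
  have -> : (-1) ^+ k = - (-1) ^+ s :> 'F_p.
    have : (-1) ^+ (s + k.+1) = 1 :> 'F_p.
      by rewrite -signr_odd addnS; case/dvdnP: d => q ->; rewrite mulnCA oddM.
    rewrite exprD exprS mulN1r mulrN => /eqP; rewrite eqr_oppLR => /eqP h.
    by rewrite -[LHS](signrMK s) h mulrN1.
  by ring.
rewrite (sum_bin_inv_dvd pcharFp6).
rewrite mulrBr mulr1 -mulp1 [_ * mulp 1]mulrC mulpM mul1r.
rewrite addrA -mulpD addrAC -mulpD addrC; congr (_ + _); rewrite -mulpN; congr mulp.
have c0 : (C%:R : 'F_p) != 0 := bin_3m_neq0 pcharFp6.
by field; rewrite two0 three0 six0 c0.
Qed.

Definition hyper_weight (k : nat) : R := ((- 2) ^+ k * k`!%:R ^+ 2)^-1.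

Local Notation w := hyper_weight.
Local Notation U := (@sym_rising R).
Local Notation S := (hyper_sum w p).
Local Notation th := (mulp 3^-1).

Lemma coprime_prime_lt k : (0 < k < p)%N -> coprime k p.
Proof. by case/andP=> k0 kp; rewrite coprime_sym prime_coprime // gtnNdvd. Qed.

Lemma natr_unit_lt k : (0 < k < p)%N -> (k%:R : R) \is a GRing.unit.
Proof. by move/coprime_prime_lt/unit_natr. Qed.

Lemma Fp_m_gt0 : (0 < m)%N. Proof. exact: pchar_m_gt0 pcharFp6. Qed.

Lemma two_unit : (2 : R) \is a GRing.unit.
Proof. by apply: natr_unit_lt; have := Fp_m_gt0; lia. Qed.

Lemma hyper_weight0 : w 0 = 1.
Proof. by rewrite /w expr0 fact0 expr1n mulr1 invr1. Qed.

Lemma hyper_weightS k : (k.+1 < p)%N -> w k = - 2 * k.+1%:R ^+ 2 * w k.+1.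
Proof.
move=> kp; have uk : (- 2 * k.+1%:R ^+ 2 : R) \is a GRing.unit.
  by rewrite unitrM unitrN two_unit unitrX ?natr_unit_lt.
have uf n : (n < p)%N -> (n`!%:R : R) \is a GRing.unit.
  elim: n => [|n IHn] np; first by rewrite unitr1.
  by rewrite factS natrM unitrM IHn ?natr_unit_lt // ltnW.
have uw : ((- 2) ^+ k * k`!%:R ^+ 2 : R) \is a GRing.unit.
  by rewrite unitrM !unitrX ?unitrN ?two_unit ?uf // ltnW.
rewrite /w factS natrM [(- 2) ^+ k.+1]exprS exprMn mulrACA [in RHS]invrM //.
by rewrite [RHS]mulrC -mulrA mulVr // mulr1.
Qed.

(** At a shift of -p/3 of an integer strictly between 0 and p - 1, each of the two
    runs of p - 1 consecutive factors contains a multiple of p. *)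
Lemma sym_rising_pred_p v : (0 < v < p.-1)%N -> U p.-1 (v%:R - th) = 0.
Proof.
case/andP=> v0 vp; rewrite /sym_rising big_split /=.
have v2 : (p.-1 - v < p.-1)%N by lia.
rewrite (bigD1 (Ordinal vp)) //= [X in _ * X](bigD1 (Ordinal v2)) //=.
have -> : v%:R - th - v%:R = - th by rewrite addrAC subrr sub0r.
have -> : v%:R - th + 1 + (p.-1 - v)%:R = mulp (1 - 3^-1).
  have -> : mulp (1 - 3^-1) = p%:R - th by rewrite mulpD mulpN mulp1.
  have -> : p%:R = v%:R + 1 + (p.-1 - v)%:R :> R.
    by rewrite natr1 -natrD; congr (_%:R); lia.
  by ring.
by rewrite mulrACA mulNr mulp_mul0 oppr0 mul0r.
Qed.

Lemma hyper_sum_rec v : (0 < v < p.-1)%N ->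
  (v.+1%:R - th) * S (v.+1%:R - th) = - (v%:R - th) * S (v.-1%:R - th).
Proof.
move=> vp; have pS : p = p.-1.+1 by rewrite prednK ?prime_gt0.
have := @hyper_sum_contiguous R w p.-1 (v%:R - th) hyper_weight0.
rewrite sym_rising_pred_p // mulr0 mul0r -pS.
have -> : v%:R - th + 1 = v.+1%:R - th by rewrite -[v.+1%:R]natr1 addrAC.
have -> : v%:R - th - 1 = v.-1%:R - th.
  by case: v vp => // v _; rewrite -[v.+1%:R]natr1 addrAC addrK.
move=> /(_ _)/eqP h; rewrite mulNr; apply/eqP; rewrite -addr_eq0; apply: h.
by move=> k kp; apply: hyper_weightS; rewrite pS ltnS.
Qed.

(** The factor i = 0 is already a multiple of p, so the others count modulo p
    only: they are -i (i + 1), and the product telescopes. *)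
Lemma hyper_term_th k : (k < 6 * m)%N ->
  U k.+1 (- th) * w k.+1 = mulp (3^-1 * ((2^-1) ^+ k.+1 / k.+1%:R)).
Proof.
have two0 : (2 : 'F_p) != 0 by apply: (natf_neq0_lt pcharFp6); have := Fp_m_gt0; lia.
elim: k => [|k IHk] km.
  have -> : U 1 (- th) = - th.
    rewrite /sym_rising big_ord1 subr0 addr0 mulrDr mulr1 mulrNN mulp_mul0 add0r.
    by [].
  have w1 : 1 = - 2 * w 1.
    have := @hyper_weightS 0; rewrite hyper_weight0 expr1n mulr1; apply.
    exact: prime_gt1.
  apply: (mulIr two_unit); rewrite [RHS]mulpM.
  have -> : - th * w 1 * 2 = th * (- 2 * w 1) by ring.
  by rewrite -w1 mulr1 expr1 divr1 divfK.
have k0 : (k.+1%:R : 'F_p) != 0 by apply: (natf_neq0_lt pcharFp6); lia.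
have k1 : (k.+2%:R : 'F_p) != 0 by apply: (natf_neq0_lt pcharFp6); lia.
have kp : (0 < k.+2 < p)%N by rewrite pE; lia.
have u : (2 * k.+2%:R ^+ 2 : R) \is a GRing.unit.
  by rewrite unitrM two_unit unitrX ?natr_unit_lt.
apply: (mulIr u).
have hw : w k.+2 * (2 * k.+2%:R ^+ 2) = - w k.+1.
  by rewrite [w k.+1]hyper_weightS; [ring | case/andP: kp].
rewrite -mulrA hw sym_risingS mulrN -mulNr -mulrN mulrAC IHk ?(ltnW km) //.
rewrite -natrX -natrM mulpM.
have -> : mulp (3^-1 * (2^-1 ^+ k.+1 / k.+1%:R)) * - ((- th - k.+1%:R) * (- th + 1 + k.+1%:R)) =
    mulp (3^-1 * (2^-1 ^+ k.+1 / k.+1%:R)) * (k.+1 * k.+2)%:R.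
  rewrite natrM -[k.+2%:R]natr1.
  move: (mulp_mul0 (3^-1 * (2^-1 ^+ k.+1 / k.+1%:R)) 3^-1).
  move: (mulp _) (k.+1%:R : R) => x y h.
  have -> : x * - ((- th - y) * (- th + 1 + y)) = x * (y * (y + 1)) + x * th * (1 - th) by ring.
  by rewrite h mul0r addr0.
rewrite mulpM; congr mulp; rewrite [in RHS]exprS !natrM.
have e (K : fieldType) (x y z t : K) : x != 0 -> y != 0 -> (2 : K) != 0 ->
    t * (z / x) * (x * y) = t * (2^-1 * z / y) * (2 * (y * y)).
  by move=> x0 y0 t0; field; rewrite x0 y0 t0.
exact: e.
Qed.

Lemma hyper_sum_th : S (- th) = 1 - mulp (H (3 * m) / 6).
Proof.
have two0 : (2 : 'F_p) != 0 by apply: (natf_neq0_lt pcharFp6); have := Fp_m_gt0; lia.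
have three0 : (3 : 'F_p) != 0 by apply: (natf_neq0_lt pcharFp6); have := Fp_m_gt0; lia.
have six0 : (6 : 'F_p) != 0 by apply: (natf_neq0_lt pcharFp6); have := Fp_m_gt0; lia.
have -> : S (- th) = \sum_(k < (6 * m).+1) U k (- th) * w k.
  by rewrite /hyper_sum -pE.
rewrite big_ord_recl /= hyper_weight0 mulr1 {1}/sym_rising big_ord0; congr (_ + _).
rewrite (eq_bigr _ (fun k _ => hyper_term_th (ltn_ord k))) -raddf_sum -mulr_sumr.
rewrite (sum_log_half pcharFp6) -mulpN; congr mulp.
by field; rewrite two0 three0 six0.
Qed.

(** Normal form of a first-order expansion, with all multiples of p gathered
    under mulp. *)
Lemma mulp_expand x z n c :
  (mulp x - n%:R) * c%:R * (1 + mulp z) =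
  mulp ((x - n%:R * z) * c%:R) - n%:R * c%:R.
Proof.
rewrite -mulpM mulpD mulpN [n%:R * z]mulrC -mulpM.
have := mulp_mul0 x z; move: (mulp x) (mulp z) => s t h.
have -> : (s - n%:R) * c%:R * (1 + t) =
  (s - t * n%:R) * c%:R - n%:R * c%:R + s * t * c%:R by ring.
by rewrite h mul0r addr0.
Qed.

(** Since 2i C(3m, i) = (p - (2i - 1)) C(3m, i - 1), the ratio of
    consecutive sums differs from that of binomial coefficients by a factor
    1 + p (2/3 / (2i - 1) + 1/6 / i). *)
Lemma hyper_sum_even j : (j <= m)%N ->
  S ((2 * j)%:R - th) =
  'C(3 * m, j)%:R * (1 + mulp (2 / 3 * odd_harm 'F_p j + H j / 6)) * S (- th).
Proof.
have two0 : (2 : 'F_p) != 0 by apply: (natf_neq0_lt pcharFp6); have := Fp_m_gt0; lia.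
have three0 : (3 : 'F_p) != 0 by apply: (natf_neq0_lt pcharFp6); have := Fp_m_gt0; lia.
have six0 : (6 : 'F_p) != 0 by apply: (natf_neq0_lt pcharFp6); have := Fp_m_gt0; lia.
elim: j => [|j IHj] jm.
  rewrite muln0 sub0r bin0 mul1r /odd_harm /harm !big_ord0 mulr0 mul0r addr0.
  by rewrite (raddf0 mulp) addr0 mul1r.
have u : ((2 * j.+1)%:R - th : R) \is a GRing.unit.
  have : ((2 * j.+1)%:R - th) * ((2 * j.+1)%:R + th) \is a GRing.unit.
    rewrite -subr_sqr [th ^+ 2]expr2 mulp_mul0 subr0 unitrX // natr_unit_lt // pE.
    by lia.
  by rewrite unitrM => /andP[].
apply: (mulrI u).
have := @hyper_sum_rec (2 * j).+1; have -> : ((2 * j).+2 = 2 * j.+1)%N by lia.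
move=> -> /=; last by rewrite pE; lia.
rewrite IHj ?(ltnW jm) // !mulrA; congr (_ * _).
have O0 : ((2 * j).+1%:R : 'F_p) != 0 by apply: (natf_neq0_lt pcharFp6); lia.
have J0 : (j.+1%:R : 'F_p) != 0 by apply: (natf_neq0_lt pcharFp6); lia.
have bR : (2 * j.+1)%:R * 'C(3 * m, j.+1)%:R =
    (mulp 1 - (2 * j).+1%:R) * 'C(3 * m, j)%:R :> R.
  rewrite mulp1 -natrB; last by rewrite pE; lia.
  by rewrite -!natrM -mulnA mul_bin_left mulnA; congr (_ * _)%:R; rewrite pE; lia.
have bF : 'C(3 * m, j.+1)%:R = - ((2 * j).+1%:R / 2 * 'C(3 * m, j)%:R / j.+1%:R) :> 'F_p.
  apply: (mulfI (mulf_neq0 two0 J0)).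
  have -> : 2 * j.+1%:R * - ((2 * j).+1%:R / 2 * 'C(3 * m, j)%:R / j.+1%:R) =
      - (2 * j).+1%:R * 'C(3 * m, j)%:R :> 'F_p.
    move: J0; move: (j.+1%:R : 'F_p) => J J0.
    by field; rewrite J0 two0.
  rewrite -(natf_reflect pcharFp6); last by lia.
  by rewrite -!natrM -mulnA mul_bin_left mulnA; congr (_ * _)%:R; lia.
rewrite /odd_harm big_ord_recr /= -/(odd_harm _ j) harmS -mul2n.
set e := 2 / 3 * odd_harm 'F_p j + H j / 6.
have -> : 2 / 3 * (odd_harm 'F_p j + (2 * j).+1%:R^-1) + (H j + j.+1%:R^-1) / 6 =
    e + (2 / 3 / (2 * j).+1%:R + j.+1%:R^-1 / 6) by rewrite /e; ring.
set d := 2 / 3 / _ + _ / 6.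
have -> : ((2 * j.+1)%:R - th) * 'C(3 * m, j.+1)%:R * (1 + mulp (e + d)) =
   (mulp 1 - (2 * j).+1%:R) * 'C(3 * m, j)%:R * (1 + mulp (e + d)) -
   th * 'C(3 * m, j.+1)%:R.
  rewrite -bR mulrBl [in LHS]mulrBl; congr (_ - _).
  by rewrite mulrDr mulr1 [th * _ * mulp _]mulrAC mulp_mul0 mul0r addr0.
rewrite mulpM mulp_expand.
have -> : - ((2 * j).+1%:R - th) * 'C(3 * m, j)%:R * (1 + mulp e) =
    (mulp 3^-1 - (2 * j).+1%:R) * 'C(3 * m, j)%:R * (1 + mulp e) by ring.
rewrite mulp_expand addrAC -mulpN -mulpD bF; congr (mulp _ - _).
have id (K : fieldType) (o c f l : K) : o != 0 -> l != 0 ->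
    (2 : K) != 0 -> (3 : K) != 0 -> (6 : K) != 0 ->
    (1 - o * (f + (2 / 3 / o + l^-1 / 6))) * c - 3^-1 * - (o / 2 * c / l) =
    (3^-1 - o * f) * c.
  by move=> o0 l0 t2 t3 t6; field; rewrite ?o0 ?l0 ?t2 ?t3 ?t6.
by apply/esym/id.
Qed.

(** The hypergeometric side: the correction to the binomial coefficient is the
    same combination of harmonic numbers as for the character sum. *)
Lemma hyper_sum_lift :
  S ((2 * m)%:R - th) =
  C%:R + mulp (C%:R * (H m / 6 + H (2 * m) / 3 - H (3 * m) / 2)).
Proof.
rewrite hyper_sum_even // hyper_sum_th odd_harmE -mul2n.
set e := 2 / 3 * _ + _; set f := H (3 * m) / 6.
have -> : C%:R * (1 + mulp e) * (1 - mulp f) = C%:R + mulp ((e - f) * C%:R).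
  rewrite -[mulp ((e - f) * _)]mulpM [mulp (e - f)]mulpD mulpN.
  have := mulp_mul0 e f; move: (mulp e) (mulp f) => x y h.
  have -> : C%:R * (1 + x) * (1 - y) = C%:R + (x - y) * C%:R - C%:R * (x * y) :> R by ring.
  by rewrite h mulr0 subr0.
congr (_ + mulp _); rewrite mulrC; congr (_ * _); rewrite /e /f.
have -> : H (3 * m) = H m - H (2 * m) by rewrite -opprB (harm_trisect pcharFp6) opprK.
have id (K : fieldType) (x y : K) : (2 : K) != 0 -> (3 : K) != 0 -> (6 : K) != 0 ->
    2 / 3 * (y - x / 2) + x / 6 - (x - y) / 6 = x / 6 + y / 3 - (x - y) / 2.
  by move=> t2 t3 t6; field; rewrite ?t2 ?t3 ?t6.
by apply: id; apply: (natf_neq0_lt pcharFp6); have := Fp_m_gt0; lia.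
Qed.

Definition bin23 (k : nat) : nat := 'C(2 * k, k) * 'C(3 * k, k).

Lemma bin23S k : (k.+1 ^ 2 * bin23 k.+1 = 3 * (3 * k + 1) * (3 * k + 2) * bin23 k)%N.
Proof.
have f n : (bin23 n * n`! ^ 3 = (3 * n)`!)%N.
  rewrite -(@bin_fact (3 * n) n) ?leq_pmull //.
  have -> : (3 * n - n = 2 * n)%N by lia.
  rewrite -(@bin_fact (2 * n) n) ?leq_pmull //.
  have -> : (2 * n - n = n)%N by lia.
  by rewrite /bin23; ring.
have := f k.+1; have -> : (3 * k.+1 = (3 * k).+3)%N by lia.
rewrite !factS -f => h.
have k0 : (0 < k`! ^ 3 * k.+1)%N by rewrite muln_gt0 expn_gt0 fact_gt0.
apply/eqP; rewrite -(eqn_pmul2r k0); apply/eqP.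
transitivity (bin23 k.+1 * (k.+1 * k`!) ^ 3)%N; first by ring.
by rewrite h; ring.
Qed.

Local Notation a := ((2 * m)%:R - th).

(** The shift 2m - p/3 is -1/3, the parameter of the theorem. *)
Lemma three_a : 3 * a = - 1.
Proof.
have three0 : (3 : 'F_p) != 0 by apply: (natf_neq0_lt pcharFp6); have := Fp_m_gt0; lia.
rewrite mulrBr [3 * th]mulrC mulpM mulVf // mulp1 -natrM pE mulnA -[(6 * m).+1%:R]natr1.
by rewrite opprD addrA subrr sub0r.
Qed.

Lemma hyper_term_bin k : (k < p)%N -> U k a * w k * 54 ^+ k = (bin23 k)%:R.
Proof.
elim: k => [|k IHk] kp.
  by rewrite /sym_rising big_ord0 hyper_weight0 /bin23 !bin0 !mul1r.
have u : (2 * k.+1%:R ^+ 2 : R) \is a GRing.unit.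
  by rewrite unitrM two_unit unitrX ?natr_unit_lt.
apply: (mulIr u).
have e9 : 9 * ((a - k%:R) * (a + 1 + k%:R)) = - ((3 * k + 1) * (3 * k + 2))%:R.
  have -> : 9 * ((a - k%:R) * (a + 1 + k%:R)) =
     (3 * a - 3 * k%:R) * (3 * a + 3 + 3 * k%:R) by ring.
  by rewrite three_a; ring.
have -> : (bin23 k.+1)%:R * (2 * k.+1%:R ^+ 2) =
    2 * (3 * ((3 * k + 1) * (3 * k + 2))%:R * (bin23 k)%:R) :> R.
  rewrite [LHS]mulrC -natrX -!natrM; congr _%:R.
  by rewrite -mulnA bin23S; ring.
have -> : ((3 * k + 1) * (3 * k + 2))%:R = - (9 * ((a - k%:R) * (a + 1 + k%:R))).
  by rewrite e9 opprK.
rewrite -IHk ?(ltnW kp) // sym_risingS (hyper_weightS kp) exprS.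
by ring.
Qed.

Lemma sum_bin23_lift :
  \sum_(k < p) (bin23 k)%:R * 54 ^+ (p.-1 - k) = 54 ^+ p.-1 * S a :> R.
Proof.
rewrite /hyper_sum mulr_sumr; apply: eq_bigr => k _.
have kp : (k <= p.-1)%N by have := ltn_ord k; lia.
rewrite -hyper_term_bin ?ltn_ord // -[RHS]mulrC -[in RHS](subnKC kp) exprD.
by ring.
Qed.

(** With y = p / C the two evaluations read 2A = S + y, and y (2A) = p; the
    powers of 54 clear denominators. *)
Lemma bin23_sum_congr (A : int) : cubic_sum m (1 : 'F_p) = - (2 * A) ->
  (2 * A)%:~R * (\sum_(k < p) (bin23 k)%:R * 54 ^+ (p.-1 - k)) =
  54 ^+ p.-1 * ((2 * A)%:~R ^+ 2 - p%:R) :> R.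
Proof.
move=> cA; have e : (2 * A)%:~R =
   C%:R + mulp (C%:R^-1 + C%:R * (H m / 6 + H (2 * m) / 3 - H (3 * m) / 2)) :> R.
  by rewrite -[2 * A]opprK -cA rmorphN /= cubic_sum_lift opprB opprK addrC.
rewrite sum_bin23_lift hyper_sum_lift mulrCA; congr (_ * _).
move: e; rewrite mulpD; set z := mulp (_ * _); set y := mulp _^-1 => e.
have -> : C%:R + z = (2 * A)%:~R - y by rewrite e; ring.
rewrite mulrBr expr2; congr (_ - _).
have yy : y * y = 0 by exact: mulp_mul0.
have zy : z * y = 0 by exact: mulp_mul0.
have Cy : y * C%:R = p%:R by rewrite /y mulpM mulVf ?mulp1 // (bin_3m_neq0 pcharFp6).
by rewrite e mulrDl mulrDl yy zy !addr0 mulrC.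
Qed.
End SixM.
End SquareZero.

(** * Congruences between fractions *)

Lemma pintegral_frac (p : nat) (n d : int) : prime p -> coprime `|d|%N p ->
  n%:~R / d%:~R \in pintegral p.
Proof.
move=> pp cop; have d0 : d != 0.
  apply: contraTneq cop => ->; rewrite /coprime gcd0n.
  by apply/eqP => p1; move: pp; rewrite p1.
rewrite unfold_in; set x := _ / _.
have dR : (d%:~R : rat) != 0 by rewrite intr_eq0.
have e : numq x * d = n * denq x.
  apply/eqP; rewrite -(eqr_int rat) !rmorphM /=; apply/eqP.
  by rewrite numqE mulrAC /x divfK.
have : (`|denq x| %| `|numq x| * `|d|)%N.
  by rewrite -abszM e abszM dvdn_mull.
rewrite Gauss_dvdr; last by rewrite coprime_sym coprime_num_den.
by move=> dd; apply: coprime_dvdl dd cop.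
Qed.

Lemma dvdz_Zp (q : nat) (N : int) : (1 < q)%N -> N%:~R = 0 :> 'Z_q -> (q %| `|N|)%N.
Proof.
move=> q1 N0.
have : (`|N|%N%:R : 'Z_q) = 0.
  case: (intP N) N0 => [|n|n] //; rewrite ?rmorphN /= ?abszN // => /eqP.
  by rewrite oppr_eq0 => /eqP.
by move/(congr1 val); rewrite /= val_Zp_nat // => /eqP.
Qed.

Theorem theorem2p2 (p : nat) (A B : int)
  (hp : prime p) (hp3 : p = 1 %[mod 3])
  (hAB : p%:Z = A ^+ 2 + 3 * B ^+ 2) (hA : (A = 1 %[mod 3])%Z) :
  congr_psqr p
    (\sum_(0 <= k < p)
        ('C(2 * k, k)%:R * 'C(3 * k, k)%:R) / (54%:R : rat) ^+ k)
    (2 * A%:~R - p%:R / (2 * A%:~R)).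
Proof.
have p_odd : odd p by case: (even_prime hp) hp3 => [->|].
pose m := (p %/ 6)%N.
have pE : p = (6 * m).+1 by rewrite /m; lia.
have cardF : #|'F_p| = (6 * m).+1 by rewrite card_Fp.
have Aq : A = (A %/ 3)%Z * 3 + 1 by rewrite {1}(divz_eq A 3) hA.
have psi : cubic_sum m (1 : 'F_p) = - (2 * A).
  have [a [e [ea]]] := cubic_sum_form cardF.
  rewrite cardF -pE => pa.
  have [c ec] := cubic_sum1_mod3 cardF.
  (* The residues modulo 3 decide between A and -A. *)
  have := sqr_form3_uniq hp hAB pa => /eqP.
  rewrite ea in ec *; move: ec Aq; move: (A %/ 3)%Z => q ec Aq.
  by rewrite eqf_sqr => /orP[] /eqP aA; lia.
have p7 : (7 <= p)%N by have := prime_gt1 hp; lia.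
have cop54 : coprime 54 p.
  rewrite (_ : 54 = 2 * 3 ^ 3)%N // coprimeMl coprimeXl.
    by rewrite andbT coprime_sym prime_coprime // gtnNdvd //; lia.
  by rewrite coprime_sym prime_coprime // gtnNdvd //; lia.
have copA : coprime `|(2 * A)%R|%N p.
  rewrite abszM coprimeMl; apply/andP; split.
    by rewrite coprime_sym prime_coprime // gtnNdvd //; lia.
  rewrite coprime_sym prime_coprime // gtnNdvd //; first by lia.
  have a2 : (`|A| ^ 2 <= p)%N.
    by rewrite -abszX -lez_nat abszE ger0_norm ?sqr_ge0 // hAB lerDl mulr_ge0 ?sqr_ge0.
  rewrite ltnNge; apply/negP => pa; move: a2; rewrite leqNgt => /negP; apply.
  by apply: leq_trans (leq_mul pa pa); rewrite -{1}[p]muln1 ltn_pmul2l ?prime_gt1 ?prime_gt0.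
have A0 : (2 * A%:~R : rat) != 0.
  by rewrite mulf_neq0 // intr_eq0; apply/eqP => A0; move: hA; rewrite A0.
have f54 : (54 : rat) ^+ p.-1 != 0 by rewrite expf_neq0.
pose T : int := \sum_(k < p) (bin23 k)%:R * 54 ^+ (p.-1 - k).
have sE : \sum_(0 <= k < p) ('C(2 * k, k)%:R * 'C(3 * k, k)%:R) / (54%:R : rat) ^+ k =
    T%:~R / (54 ^+ p.-1)%:~R.
  rewrite big_mkord /T rmorph_sum mulr_suml /=; apply: eq_bigr => k _.
  have kp : (k <= p.-1)%N by have := ltn_ord k; lia.
  rewrite rmorphM !rmorphXn /= rmorph_nat -natrM -/(bin23 k).
  have -> : (54 : rat) ^+ p.-1 = 54 ^+ (p.-1 - k) * 54 ^+ k by rewrite -exprD subnK.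
  by rewrite [_%:R * 54 ^+ _]mulrC -mulf_div divff ?expf_neq0 // mul1r.
have e2 : (2 * A)%:~R = 2 * A%:~R :> rat by rewrite rmorphM.
have vE : 2 * A%:~R - p%:R / (2 * A%:~R) =
    ((2 * A) ^+ 2 - p%:Z)%:~R / (2 * A)%:~R :> rat.
  rewrite rmorphB rmorphXn /= e2 -pmulrn.
  by move: A0; move: (2 * _) => x x0; field.
have cop54n : coprime `|(54 : int) ^+ p.-1|%N p.
  by rewrite abszX coprimeXl.
rewrite /congr_psqr sE vE !pintegral_frac //=.
pose N : int := 2 * A * T - 54 ^+ p.-1 * ((2 * A) ^+ 2 - p%:Z).
have TE (S : comNzRingType) :
    T%:~R = \sum_(k < p) (bin23 k)%:R * 54 ^+ (p.-1 - k) :> S.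
  rewrite /T rmorph_sum /=; apply: eq_bigr => k _.
  by rewrite rmorphM rmorphXn /= !rmorph_nat.
have NE (S : comNzRingType) : N%:~R =
    (2 * A)%:~R * T%:~R - 54 ^+ p.-1 * ((2 * A)%:~R ^+ 2 - p%:R) :> S.
  rewrite /N rmorphB /= [(2 * A * T)%:~R]rmorphM [(54 ^+ _ * _)%:~R]rmorphM /=.
  by rewrite rmorphB !rmorphXn /= rmorph_nat -pmulrn.
have N0 : (p ^ 2 %| `|N|)%N.
  have pp1 : (1 < p ^ 2)%N by rewrite -{1}(expn0 p) ltn_exp2l // prime_gt1.
  apply: dvdz_Zp => //.
  have p2 : p%:R ^+ 2 = 0 :> 'Z_(p ^ 2) by rewrite -natrX; apply: pchar_Zp.
  by rewrite NE TE -(bin23_sum_congr hp p2 pE psi) subrr.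
have -> : T%:~R / (54 ^+ p.-1)%:~R - ((2 * A) ^+ 2 - p%:Z)%:~R / (2 * A)%:~R =
   N%:~R / (54 ^+ p.-1 * (2 * A))%:~R :> rat.
  rewrite -vE NE [(_ * (2 * A))%:~R]rmorphM !rmorphXn /= e2.
  by move: A0 f54; move: (2 * _) (54 ^+ _) => x y x0 y0; field; rewrite x0 y0.
have [M NM] : exists M : int, N = M * p%:Z ^+ 2.
  by exists (N %/ p%:Z ^+ 2)%Z; rewrite divzK // dvdzE abszX.
rewrite NM rmorphM /= rmorphXn /= -pmulrn mulrAC mulfK; last first.
  by rewrite expf_neq0 // pnatr_eq0; lia.
by rewrite pintegral_frac // abszM coprimeMl cop54n.
Qed.
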